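(* Let $d\in\mathbb{N}$, $d\ge1$, let $K\subset\mathbb{R}^d$ be a bounded domain with $C^2$ boundary which is starshaped with respect to a ball $B_r(x_0)$ for some $r>0$ and $x_0\in K$, let $\lambda>0$, and let $(u_\lambda,\Omega_\lambda)$ be the unique solution of the exterior Bernoulli problem for the half Laplacian with data $K$ and $\lambda$. Then for every $x\in\partial\Omega_\lambda$ the inward normal ray $\{x+tn(x):t\ge0\}$ to $\partial\Omega_\lambda$ at $x$, where $n(x)$ is the inward unit normal vector to $\Omega_\lambda$ at $x$, meets the convex envelope (convex hull) of $\overline K$.
   Context: A domain is a nonempty connected open set; it is of class $C^k$ (has $C^k$ boundary) if its boundary is locally the graph of a $C^k$ function. $B_r(\xi)$ is the open ball of radius $r$ centered at $\xi$. A domain $A$ is starshaped with respect to a point $\xi\in A$ if $\mu(A-\xi)+\xi\subseteq A$ for every $\mu\in[0,1]$; it is starshaped with respect to a set $B\subseteq A$ if it is starshaped with respect to every point of $B$. The half Laplacian is $$(-\Delta)^{1/2}f(x)=\frac{\Gamma\left(\frac{d+1}{2}\right)}{2\pi^{\frac{d+1}{2}}}\int_{\mathbb{R}^d}\frac{2f(x)-f(x+z)-f(x-z)}{|z|^{d+1}}\,dz.$$ For $x\in\partial\Omega$ with inward unit normal $n(x)$, $$D_\Omega^{1/2}u(x)=\lim_{t\to0^+}\frac{u(x+tn(x))-u(x)}{t^{1/2}}.$$ Exterior Bernoulli problem with data $K$ (bounded domain) and $\lambda>0$: find a continuous function $u:\mathbb{R}^d\to[0,1]$ and a domain $\Omega\supset\overline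 K$ of class $C^1$ with $(-\Delta)^{1/2}u=0$ in $\Omega\setminus\overline K$, $u=1$ on $\overline K$, $u=0$ on $\Omega^c=\mathbb{R}^d\setminus\Omega$, and $D_\Omega^{1/2}u=\lambda$ on $\partial\Omega$. Known fact (may be used): if $K$ is a bounded domain with $C^2$ boundary, starshaped with respect to a ball $B_r(x_0)$ with $r>0$, $x_0\in K$, then for every $\lambda>0$ this problem has a unique solution $(u_\lambda,\Omega_\lambda)$; moreover $\Omega_\lambda$ is bounded, starshaped with respect to $B_r(x_0)$ and of class $C^\infty$, and $u_\lambda\in H^{1/2}(\mathbb{R}^d)$.
   Formalization: The unique solution is understood as the unique one with bounded Ω, since u = 1, Ω = R^d also satisfies every condition of the problem as written; the known properties of the solution (bounded, starshaped, smooth domain, u in H^{1/2}) are taken as given. *)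

(* Defs.v *)
From HB Require Import structures.
From mathcomp Require Import all_boot all_order all_algebra.
From mathcomp Require Import all_classical all_reals all_analysis.

Set Implicit Arguments.
Unset Strict Implicit.
Unset Printing Implicit Defensive.

Import Order.TTheory GRing.Theory Num.Theory.
Import numFieldNormedType.Exports.

Local Open Scope classical_set_scope.
Local Open Scope ring_scope.

(* MathComp-Analysis. Points of R^d are row vectors 'rV[R]_d. The library norm
   `|x| on 'rV[R]_d is the sup norm: it is only used for the (same) topology
   and for boundedness; lengths and balls are the Euclidean ones below. *)

Section euclidean.
Context {R : realType} {d : nat}.
Implicit Types (x y : 'rV[R]_d) (r : R) (A B : set 'rV[R]_d).

Definition enorm x : R := Num.sqrt (\sum_i x ord0 i ^+ 2).

Definition eball x r : set 'rV[R]_d := [set y | enorm (y - x) < r].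

Definition boundary A : set 'rV[R]_d := closure A `\` A°.

Definition domain A : Prop := [/\ A !=set0, open A & connected A].

Definition starshaped_at A xi : Prop :=
  A xi /\ forall mu : R, 0 <= mu <= 1 ->
    [set mu *: (a - xi) + xi | a in A] `<=` A.

Definition starshaped_wrt A B : Prop := forall xi, B xi -> starshaped_at A xi.

Definition convex_hull A : set 'rV[R]_d := smallest (@convex_set R 'rV[R]_d) A.

End euclidean.

Section boundary_regularity.
Context {R : realType}.

(* All partial derivatives of order at most k exist and are continuous. *)
Fixpoint class_C {n : nat} (k : nat) (f : 'rV[R]_n -> R) : Prop :=
  continuous f /\
  if k is k'.+1 then
    forall i : 'I_n, (forall x, derivable f x (delta_mx ord0 i)) /\
      class_C k' ('D_(delta_mx ord0 i) f)
  else True.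

Definition class_Cinfty {n : nat} (f : 'rV[R]_n -> R) : Prop :=
  forall k, class_C k f.

Context {d : nat}.
Implicit Types (A : set 'rV[R]_d) (x z : 'rV[R]_d) (Q : 'M[R]_d) (j : 'I_d).

(* In the ball of radius rho centered at x, and in the orthonormal coordinates
   y = (z - x) *m Q, the set A is the part above the graph
   y_j = g (y_i)_(i != j), and its boundary is this graph. *)
Definition graph_chart A x (rho : R) Q j (g : 'rV[R]_d.-1 -> R) : Prop :=
  [/\ 0 < rho, Q *m Q^T = 1%:M &
    forall z, eball x rho z ->
      let y := (z - x) *m Q in
      (A z <-> g (col' j y) < y ord0 j) /\
      (boundary A z <-> y ord0 j = g (col' j y))].

Definition has_boundary_of_class (C : ('rV[R]_d.-1 -> R) -> Prop) A : Prop :=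
  forall x, boundary A x -> exists rho Q j g, C g /\ graph_chart A x rho Q j g.

(* The vector (- grad g, 1), in the coordinates ((y_i)_(i != j), y_j), which is
   normal to the graph of g above w and points upwards. *)
Definition graph_normal j (g : 'rV[R]_d.-1 -> R) (w : 'rV[R]_d.-1) :
    'rV[R]_d :=
  \row_k if unlift j k is Some i then - 'D_(delta_mx ord0 i) g w else 1.

(* The point x has coordinates y = 0 in a chart at x; multiplication by Q^T
   goes back to the original coordinates. *)
Definition inward_unit_normal A x (nu : 'rV[R]_d) : Prop :=
  exists rho Q j g,
    [/\ class_C 1 g, graph_chart A x rho Q j g &
      let v := graph_normal j g 0 in nu = (enorm v)^-1 *: (v *m Q^T)].

End boundary_regularity.

(* Lebesgue measure on R^n, carried by n.-tuple R, for which the library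
   provides the product (Borel) sigma-algebra: Lebesgue measure on R^n.+1 is
   the image of the product of the Lebesgue measures on R and on R^n by
   (a, t) |-> a :: t. *)
Section lebesgue_cons.
Context {R : realType} {n : nat}.
Local Notation T := (measurableTypeR R).
Variable mu : {sigma_finite_measure set (n.-tuple T) -> \bar R}.

Let consp (p : T * n.-tuple T) : n.+1.-tuple T := [tuple of p.1 :: p.2].

Let measurable_consp : measurable_fun [set: T * n.-tuple T] consp.
Proof. exact: (measurable_cons measurable_fst measurable_snd). Qed.

#[local] HB.instance Definition _ :=
  isMeasurableFun.Build _ _ _ _ consp measurable_consp.

Let thead_consp p : thead (consp p) = p.1.
Proof. exact: theadE. Qed.

Let behead_consp p : [tuple of behead (consp p)] = p.2.
Proof. exact: val_inj. Qed.

Definition lebesgue_cons : set (n.+1.-tuple T) -> \bar R :=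
  pushforward ((@lebesgue_measure R) \x mu)%E consp.

Let lebesgue_cons0 : lebesgue_cons set0 = 0%E.
Proof. exact: measure0. Qed.

Let lebesgue_cons_ge0 A : (0 <= lebesgue_cons A)%E.
Proof. exact: measure_ge0. Qed.

Let lebesgue_cons_sigma_additive : semi_sigma_additive lebesgue_cons.
Proof. exact: measure_semi_sigma_additive. Qed.

HB.instance Definition _ := isMeasure.Build _ _ _ lebesgue_cons
  lebesgue_cons0 lebesgue_cons_ge0 lebesgue_cons_sigma_additive.

Lemma lebesgue_cons_prod (A : set T) (B : set (n.-tuple T)) :
  measurable A -> measurable B ->
  lebesgue_cons [set t | A (thead t) /\ B [tuple of behead t]] =
  (lebesgue_measure A * mu B)%E.
Proof.
move=> mA mB; rewrite -product_measure1E// /lebesgue_cons /pushforward.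
congr (product_measure1 _ _ _); apply/seteqP.
by split=> -[a t]/=; rewrite thead_consp behead_consp.
Qed.

Let lebesgue_cons_sigma_finite : sigma_finite setT lebesgue_cons.
Proof.
have /sigma_finiteP[F [TF ndF Foo]] := sigma_finiteT (@lebesgue_measure R).
have /sigma_finiteP[G [TG ndG Goo]] := sigma_finiteT mu.
exists (fun k => [set t | F k (thead t) /\ G k [tuple of behead t]]).
  apply/esym; rewrite -subTset => t _.
  have [i _ Fi] : (\bigcup_i F i) (thead t) by rewrite -TF.
  have [k _ Gk] : (\bigcup_i G i) [tuple of behead t] by rewrite -TG.
  exists (maxn i k) => //; split.
  - by move: Fi; exact/subsetPset/ndF/leq_maxl.
  - by move: Gk; exact/subsetPset/ndG/leq_maxr.
move=> k; have [mF Fk] := Foo k; have [mG Gk] := Goo k.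
split; last first.
  by rewrite lebesgue_cons_prod// lte_mul_pinfty// ge0_fin_numE.
apply: measurableI.
- by rewrite -[X in measurable X]setTI; exact: (measurable_tnth ord0).
- by rewrite -[X in measurable X]setTI; exact: measurable_behead.
Qed.

HB.instance Definition _ := Measure_isSigmaFinite.Build _ _ _ lebesgue_cons
  lebesgue_cons_sigma_finite.

End lebesgue_cons.

Fixpoint lebesgue_tuple {R : realType} (n : nat) :
    {sigma_finite_measure set (n.-tuple (measurableTypeR R)) -> \bar R} :=
  if n is n'.+1 then lebesgue_cons (lebesgue_tuple n')
  else dirac [tuple].

Section half_laplacian.
Context {R : realType} {d : nat}.
Implicit Types (f u : 'rV[R]_d -> R) (x z : 'rV[R]_d).

Definition row_of_tuple (t : d.-tuple (measurableTypeR R)) : 'rV[R]_d :=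
  \row_i tnth t i.

Definition Gamma (s : R) : R :=
  \int[lebesgue_measure]_(t in `]0%R, +oo[) (t `^ (s - 1) * expR (- t)).

Definition half_laplacian_kernel f x z : R :=
  (2 * f x - f (x + z) - f (x - z)) / enorm z ^+ d.+1.

Definition half_laplacian f x : R :=
  Gamma (d.+1%:R / 2) / (2 * pi `^ (d.+1%:R / 2)) *
  \int[lebesgue_tuple d]_t half_laplacian_kernel f x (row_of_tuple t).

(* The integral is a Lebesgue integral; since \int also has a value when it
   does not converge, convergence has to be required separately. *)
Definition half_laplacian_eq f x (l : R) : Prop :=
  (lebesgue_tuple d).-integrable setT
    (fun t => (half_laplacian_kernel f x (row_of_tuple t))%:E) /\
  half_laplacian f x = l.

(* D_Omega^(1/2) u (x) = l *)
Definition half_normal_derivative (Omega : set 'rV[R]_d) u x (l : R) : Prop :=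
  exists2 nu, inward_unit_normal Omega x nu &
    (u (x + t *: nu) - u x) / Num.sqrt t @[t --> 0^'+] --> l.

(* The space H^(1/2)(R^d), with its Gagliardo seminorm. *)
Definition in_H12 u : Prop :=
  [/\ measurable_fun setT (u \o row_of_tuple),
    (\int[lebesgue_tuple d]_t (u (row_of_tuple t) ^+ 2)%:E < +oo)%E &
    (\int[lebesgue_tuple d]_s \int[lebesgue_tuple d]_t
       ((u (row_of_tuple s) - u (row_of_tuple t)) ^+ 2 /
        enorm (row_of_tuple s - row_of_tuple t) ^+ d.+1)%:E < +oo)%E].

Definition exterior_bernoulli_solution (K : set 'rV[R]_d) (lambda : R)
    u (Omega : set 'rV[R]_d) : Prop :=
  [/\ continuous u /\ (forall x, 0 <= u x <= 1),
    [/\ domain Omega, has_boundary_of_class (class_C 1) Omega &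
      closure K `<=` Omega],
    forall x, (Omega `\` closure K) x -> half_laplacian_eq u x 0,
    (forall x, closure K x -> u x = 1) /\ (forall x, ~ Omega x -> u x = 0) &
    forall x, boundary Omega x -> half_normal_derivative Omega u x lambda].

End half_laplacian.

(* Main.v *)
(* By separation it is enough to reflect in hyperplanes: if the normal ray at [x]
   misses the hull C of the closure of K (which is compact by Caratheodory's
   theorem), some unit [e] satisfies [nu . e > 0] and [y . e <= x . e =: c] on C.
   Let [sigma] be the reflection across [{y . e = c}]. If [sigma] maps
   [Omega] intersected with [{y . e > c}] into [Omega], then [x + t e] in
   [Omega] gives [x - t e] in [Omega] for small [t], against [nu . e > 0].

   The inclusion follows from a scaling argument, without moving planes or a Hopf
   lemma. Let [m <= 1] be the largest factor for which the dilation of centre [x0]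
   and ratio [m] maps the reflected cap into [Omega]. The maximum principle for
   functions [w] with [w p + w (sigma p) >= 0] yields
   [u (sigma p) <= u (x0 + m (p - x0))] on [{p . e <= c}]. If [m < 1], the
   image of the cap touches the boundary of [Omega] and the normals correspond, so
   comparing the half-normal derivatives gives [lambda <= sqrt m * lambda],
   which is absurd.

   The maximum principle is pointwise: at a negative minimum the integral of the
   second difference is not zero. It uses the invariance of the Lebesgue measure
   under reflections, obtained from translation invariance and Tonelli's theorem
   as in the uniqueness proof of the Haar measure. *)
Require Import Defs.
From mathcomp Require Import all_boot all_order all_algebra.
From mathcomp Require Import all_classical all_reals all_analysis.
From mathcomp Require Import measurable_realfun.
From mathcomp Require Import ring lra.

Set Implicit Arguments.
Unset Strict Implicit.
Unset Printing Implicit Defensive.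

Import Order.TTheory GRing.Theory Num.Theory.
Import numFieldNormedType.Exports.

Local Open Scope classical_set_scope.
Local Open Scope ring_scope.

(** * Invariance of the Lebesgue measure *)

(** A measure that gives each interval []a, b]] its length is the Lebesgue measure. For [s = -1] the
    preimage of []a, b]] is closed at the other end, which leaves its length unchanged. *)
Lemma lebesgue_measure_affine (R : realType) (s v : R) (A : set (measurableTypeR R)) :
  s ^+ 2 = 1 -> measurable A ->
  lebesgue_measure ((fun x => s * x + v) @^-1` A) = lebesgue_measure A.
Proof.
move=> s1 mA.
have mphi : @measurable_fun _ _ (measurableTypeR R) (measurableTypeR R) setT (fun x => s * x + v).
  apply: (@measurable_funD _ (measurableTypeR R)); last exact: measurable_cst.
  by apply: (@measurable_funM _ (measurableTypeR R)) => //; exact: measurable_cst.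
pose phi : {mfun measurableTypeR R >-> measurableTypeR R} :=
  @mfun_Sub _ _ (measurableTypeR R) (measurableTypeR R) _ (mem_set mphi).
rewrite -/(pushforward (@lebesgue_measure R) phi A).
apply/esym/(lebesgue_measure_unique (mu := pushforward (@lebesgue_measure R) phi)) => //.
move=> X [[a b] _ <-]/=; rewrite /pushforward.
have /orP[/eqP ->|/eqP ->] : (s == 1) || (s == -1) by rewrite -sqrf_eq1 s1.
- rewrite (_ : _ @^-1` _ = `]a - v, b - v]%classic); last first.
    by apply/seteqP; split => x /=; rewrite !in_itv/= mul1r ltrBlDr lerBrDr.
  by rewrite !lebesgue_measure_itv/= !lte_fin ltrD2r -!EFinD; congr (if _ then (_)%:E else _); lra.
- rewrite (_ : _ @^-1` _ = `[v - b, v - a[%classic); last first.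
    apply/seteqP; split => x /=; rewrite !in_itv/= mulN1r => /andP[]; lra.
  by rewrite !lebesgue_measure_itv/= !lte_fin ltrD2l ltrN2 -!EFinD; congr (if _ then (_)%:E else _); lra.
Qed.

(** * Translations and point reflections of R^n, by Tonelli's theorem *)

Section lebesgue_tuple_integral.
Local Open Scope ereal_scope.
Context {R : realType}.
Local Notation T := (measurableTypeR R).
Local Notation leb := (@lebesgue_measure R).

Lemma ge0_integral_lebesgue_affine (s v : R) (f : T -> \bar R) :
  (s ^+ 2 = 1)%R -> measurable_fun setT f -> (forall x, 0 <= f x) ->
  \int[leb]_x f (s * x + v)%R = \int[leb]_x f x.
Proof.
move=> s1 mf f0.
have mphi : @measurable_fun _ _ T T setT (fun x => s * x + v)%R.
  apply: (@measurable_funD _ T); last exact: measurable_cst.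
  by apply: (@measurable_funM _ T) => //; exact: measurable_cst.
pose phi : {mfun T >-> T} := @mfun_Sub _ _ T T _ (mem_set mphi).
transitivity (\int[pushforward leb phi]_x f x).
  by rewrite ge0_integral_pushforward// preimage_setT.
by apply: eq_measure_integral => A mA _; exact: lebesgue_measure_affine.
Qed.

Lemma measurable_tuple_cons n :
  measurable_fun setT (fun p : T * n.-tuple T => [tuple of p.1 :: p.2]).
Proof. exact: (measurable_cons measurable_fst measurable_snd). Qed.

Lemma ge0_integral_lebesgue_tupleS n (f : n.+1.-tuple T -> \bar R) :
  measurable_fun setT f -> (forall t, 0 <= f t) ->
  \int[lebesgue_tuple n.+1]_t f t =
  \int[leb]_a \int[lebesgue_tuple n]_t f [tuple of a :: t].
Proof.
move=> mf f0.
pose phi : {mfun (T * n.-tuple T)%type >-> n.+1.-tuple T} :=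
  mfun_Sub (mem_set (@measurable_tuple_cons n)).
transitivity (\int[pushforward (leb \x lebesgue_tuple n) phi]_t f t).
  by apply: eq_measure_integral.
rewrite ge0_integral_pushforward// preimage_setT fubini_tonelli1//.
by apply: measurableT_comp => //; exact: measurable_tuple_cons.
by move=> p; exact: f0.
Qed.

Lemma measurable_fun_tuple_affine n (s : R) (v : 'I_n -> R) :
  @measurable_fun _ _ (n.-tuple T) (n.-tuple T) setT
    (fun t => [tuple (s * tnth t i + v i)%R | i < n]).
Proof.
apply/measurable_fun_tnthP => i.
rewrite (_ : _ \o _ = fun t : n.-tuple T => s * tnth t i + v i : T)%R; last first.
  by apply/funext => t /=; rewrite tnth_mktuple.
apply: (@measurable_funD _ _ R) => //.
by apply: (@measurable_funM _ _ R) => //; exact: measurable_tnth.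
Qed.

(** Induction on the dimension: Tonelli's theorem splits off the first coordinate, where the
    one-dimensional invariance applies. *)
Lemma ge0_integral_tuple_affine n (s : R) (v : 'I_n -> R) (f : n.-tuple T -> \bar R) :
  (s ^+ 2 = 1)%R -> measurable_fun setT f -> (forall t, 0 <= f t) ->
  \int[lebesgue_tuple n]_t f [tuple (s * tnth t i + v i)%R | i < n] =
  \int[lebesgue_tuple n]_t f t.
Proof.
move=> s1; elim: n => [|n IHn] in v f * => mf f0.
  by apply: eq_integral => t _; rewrite tuple0 [t]tuple0.
rewrite ge0_integral_lebesgue_tupleS//; last first.
  by apply: measurableT_comp => //; exact: measurable_fun_tuple_affine.
have mf2 : measurable_fun setT (fun p : T * n.-tuple T => f [tuple of p.1 :: p.2]).
  by apply: measurableT_comp => //; exact: measurable_tuple_cons.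
pose F a := \int[lebesgue_tuple n]_t f [tuple of a :: t].
transitivity (\int[leb]_a F (s * a + v ord0)%R).
  apply: eq_integral => a _; rewrite /F.
  rewrite -(IHn (fun i => v (lift ord0 i))
              (fun t => f [tuple of (s * a + v ord0)%R :: t]))//; last first.
    exact: (measurable_fun_pair2 (s * a + v ord0)%R mf2).
  apply: eq_integral => t _; congr f; apply: eq_from_tnth => i.
  rewrite tnth_mktuple; case: (unliftP ord0 i) => [j ->|->].
    by rewrite !tnthS tnth_mktuple.
  by rewrite !tnth0.
rewrite ge0_integral_lebesgue_tupleS//.
apply: ge0_integral_lebesgue_affine => //.
- exact: (@measurable_fun_fubini_tonelli_F _ _ _ _ _ (lebesgue_tuple n)
    (fun p => f [tuple of p.1 :: p.2]) mf2 (fun=> f0 _)).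
- by move=> a; exact: integral_ge0.
Qed.

Lemma lebesgue_tuple_cube n (a b : R) : (a <= b)%R ->
  lebesgue_tuple n [set t : n.-tuple T | forall i, (a <= tnth t i <= b)%R] =
  ((b - a) ^+ n)%:E.
Proof.
move=> ab; elim: n => [|n IHn].
  rewrite expr0 /= diracE mem_set//; by case.
have mI : measurable (`[a, b]%classic : set T) by [].
have mC : measurable [set t : n.-tuple T | forall i, (a <= tnth t i <= b)%R].
  rewrite (_ : mkset _ = \bigcap_(i in setT) (fun t : n.-tuple T => tnth t i) @^-1` `[a, b]%classic); last first.
    apply/seteqP; split => t /= H i; last first.
      by have : tnth t i \in `[a, b]%R := H i I; rewrite in_itv.
    by move=> _; rewrite /= in_itv/=; exact: H.
  apply: fin_bigcap_measurable; first exact: finite_finset.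
  by move=> i _; rewrite -[X in measurable X]setTI; exact: measurable_tnth.
have := lebesgue_cons_prod (lebesgue_tuple n) mI mC.
rewrite IHn lebesgue_measure_itv/= lte_fin.
set A := [set t | _]; set B := [set t | _]; have -> : A = B.
  apply/seteqP; split => t; rewrite /A /B /= in_itv/=.
    move=> [h1 h2] i; case: (unliftP ord0 i) => [j ->|->//].
    have := h2 j; rewrite tnth_behead.
    by rewrite (_ : inord _ = lift ord0 j)//; apply/val_inj; rewrite /= inordK ?ltnS ?ltn_ord.
  move=> H; split; first exact: H.
  by move=> j; rewrite tnth_behead.
move=> ->; rewrite -EFinD exprS.
case: ltrP => [//|ba]; have -> : a = b by apply/eqP; rewrite eq_le ab ba.
by rewrite subrr mul0r mul0e.
Qed.

End lebesgue_tuple_integral.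

(** * Linear changes of variables in R^d *)

Section haar.
Local Open Scope ereal_scope.
Context {R : realType} {d : nat}.
Local Notation T := (measurableTypeR R).
Local Notation Rd := 'rV[R]_d.
Local Notation mu := (@lebesgue_tuple R d).
Local Notation row := (@row_of_tuple R d).

Definition tuple_of_row (x : Rd) : d.-tuple T := [tuple x ord0 i | i < d].

Lemma tuple_of_rowK : cancel tuple_of_row row.
Proof. by move=> x; apply/rowP => i; rewrite mxE tnth_mktuple. Qed.

(** Measurability is tested on tuples, which carry the sigma-algebra and the measure. *)
Definition rowmeas d' (U : measurableType d') (f : Rd -> U) :=
  measurable_fun setT (f \o row).

Lemma measurable_row_comp dX (X : measurableType dX) dU (U : measurableType dU)
    (f : Rd -> U) (A : X -> Rd) :
  rowmeas f -> (forall i, @measurable_fun _ _ X T setT (fun x => A x ord0 i)) ->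
  measurable_fun setT (fun x => f (A x)).
Proof.
move=> mf mA; rewrite (_ : (fun x => f (A x)) = (f \o row) \o (tuple_of_row \o A)); last first.
  by apply/funext => x /=; rewrite tuple_of_rowK.
apply: measurableT_comp => //; apply/measurable_fun_tnthP => i.
by rewrite (_ : _ \o _ = fun x => A x ord0 i)//; apply/funext => x /=; rewrite tnth_mktuple.
Qed.

Lemma measurable_coord i : @measurable_fun _ _ _ T setT (fun t => row t ord0 i).
Proof.
rewrite (_ : (fun _ => _) = (fun t : d.-tuple T => tnth t i)); last first.
  by apply/funext => t; rewrite mxE.
exact: measurable_tnth.
Qed.

Lemma measurable_coord_mulmx dX (X : measurableType dX) (A : X -> Rd) (M : 'M[R]_d) :
  (forall i, @measurable_fun _ _ X T setT (fun x => A x ord0 i)) ->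
  forall i, @measurable_fun _ _ X T setT (fun x => (A x *m M) ord0 i).
Proof.
move=> mA i; rewrite (_ : (fun _ => _) = (fun x => \sum_j A x ord0 j * M j i)%R); last first.
  by apply/funext => x; rewrite mxE.
apply: (@measurable_sum _ _ R) => j.
by apply: (@measurable_funM _ _ R) => //; exact: mA.
Qed.

Lemma measurable_coordD dX (X : measurableType dX) (A B : X -> Rd) :
  (forall i, @measurable_fun _ _ X T setT (fun x => A x ord0 i)) ->
  (forall i, @measurable_fun _ _ X T setT (fun x => B x ord0 i)) ->
  forall i, @measurable_fun _ _ X T setT (fun x => (A x + B x)%R ord0 i).
Proof.
move=> mA mB i; rewrite (_ : (fun _ => _) = (fun x => A x ord0 i + B x ord0 i)%R); last first.
  by apply/funext => x; rewrite mxE.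
by apply: (@measurable_funD _ _ R); [exact: mA|exact: mB].
Qed.

Lemma measurable_coordN dX (X : measurableType dX) (A : X -> Rd) :
  (forall i, @measurable_fun _ _ X T setT (fun x => A x ord0 i)) ->
  forall i, @measurable_fun _ _ X T setT (fun x => (- A x)%R ord0 i).
Proof.
move=> mA i; rewrite (_ : (fun _ => _) = (fun x => - A x ord0 i)%R); last first.
  by apply/funext => x; rewrite mxE.
by apply: (@measurable_funN _ _ R); exact: mA.
Qed.

Lemma ge0_integral_row_affine (s : R) (v : Rd) (f : Rd -> \bar R) :
  (s ^+ 2 = 1)%R -> rowmeas f -> (forall x, 0 <= f x) ->
  \int[mu]_t f (s *: row t + v)%R = \int[mu]_t f (row t).
Proof.
move=> s1 mf f0.
rewrite -(@ge0_integral_tuple_affine R d s (fun i => v ord0 i) (f \o row))//=.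
apply: eq_integral => t _; congr f.
by apply/rowP => i; rewrite !mxE tnth_mktuple.
Qed.

(** Both sides are the double integral of [f (x M + y) * g y]: integrating first in [x] gives the
    left one, shifting [y] by [- x M] first gives the right one. *)
Lemma haar_swap (M : 'M[R]_d) (f g : Rd -> \bar R) : M \in unitmx ->
  rowmeas f -> (forall x, 0 <= f x) -> rowmeas g -> (forall x, 0 <= g x) ->
  (\int[mu]_t g (row t)) * (\int[mu]_t f (row t *m M)) =
  (\int[mu]_t f (row t)) * (\int[mu]_t g (row t *m M)).
Proof.
move=> uM mf f0 mg g0.
have mrow1 i : @measurable_fun _ _ (d.-tuple T * d.-tuple T)%type T setT (fun p => row p.1 ord0 i).
  exact: (measurableT_comp (measurable_coord i) measurable_fst).
have mrow2 i : @measurable_fun _ _ (d.-tuple T * d.-tuple T)%type T setT (fun p => row p.2 ord0 i).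
  exact: (measurableT_comp (measurable_coord i) measurable_snd).
have mfM : measurable_fun setT (fun t => f (row t *m M)).
  by apply: (measurable_row_comp mf); apply: measurable_coord_mulmx measurable_coord.
have mgM : measurable_fun setT (fun t => g (row t *m M)).
  by apply: (measurable_row_comp mg); apply: measurable_coord_mulmx measurable_coord.
have fM0 : 0 <= \int[mu]_t f (row t *m M) by exact: integral_ge0.
have gM0 : 0 <= \int[mu]_t g (row t *m M) by exact: integral_ge0.
rewrite muleC -(@ge0_integralZl _ _ _ mu setT _ (g \o row))//.
transitivity (\int[mu]_y \int[mu]_x (f (row x *m M + row y)%R * g (row y))).
  apply: eq_integral => y _.
  have shiftx : \int[mu]_x f (row x *m M) = \int[mu]_x f (row x *m M + row y)%R.
    rewrite -[LHS](@ge0_integral_row_affine 1 (row y *m invmx M) (fun x => f (x *m M)))//.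
    - by apply: eq_integral => x _; rewrite scale1r mulmxDl mulmxKV.
    - by rewrite expr1n.
  rewrite shiftx /= muleC -ge0_integralZl//.
    by apply: eq_integral => x _; rewrite muleC.
  apply: measurable_row_comp => //.
  apply: measurable_coordD; first exact: measurable_coord_mulmx measurable_coord.
  by move=> i; exact: measurable_cst.
have mfg : measurable_fun setT (fun p : d.-tuple T * d.-tuple T =>
    f (row p.2 *m M + row p.1)%R * g (row p.1)).
  apply: emeasurable_funM; apply: measurable_row_comp => //.
  by apply: measurable_coordD => //; exact: measurable_coord_mulmx.
rewrite (fubini_tonelli _ mfg) /=; last by move=> p; rewrite mule_ge0.
transitivity (\int[mu]_x \int[mu]_y (f (row y) * g (row y - row x *m M)%R)).
  apply: eq_integral => x _.
  rewrite -[LHS](@ge0_integral_row_affine 1 (- (row x *m M)) (fun y => f (row x *m M + y)%R * g y))//.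
  - by apply: eq_integral => y _; rewrite scale1r addrC subrK.
  - by rewrite expr1n.
  - apply: emeasurable_funM; last by [].
    apply: measurable_row_comp => //; apply: measurable_coordD; last exact: measurable_coord.
    by move=> i; exact: measurable_cst.
  - by move=> y; rewrite mule_ge0.
have mfg2 : measurable_fun setT (fun p : d.-tuple T * d.-tuple T =>
    f (row p.2) * g (row p.2 - row p.1 *m M)%R).
  apply: emeasurable_funM; apply: measurable_row_comp => //.
  by apply: measurable_coordD => //; apply: measurable_coordN; apply: measurable_coord_mulmx.
rewrite (fubini_tonelli _ mfg2) /=; last by move=> p; rewrite mule_ge0.
rewrite [RHS]muleC -(@ge0_integralZl _ _ _ mu setT _ (f \o row))//.
apply: eq_integral => y _ /=.
(* The substitution of [y M^-1 - x] for [x] turns [x M] into [y - x M]. *)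
have shiftx : \int[mu]_x g (row x *m M) = \int[mu]_x g (row y - row x *m M)%R.
  rewrite -[LHS](@ge0_integral_row_affine (-1) (row y *m invmx M) (fun x => g (x *m M)))//.
  - by apply: eq_integral => x _; rewrite scaleN1r mulmxDl mulmxKV// mulNmx addrC.
  - by rewrite sqrrN expr1n.
rewrite shiftx ge0_integralZl//; first by rewrite muleC.
apply: measurable_row_comp => //.
apply: measurable_coordD; first by move=> i; exact: measurable_cst.
by apply: measurable_coordN; apply: measurable_coord_mulmx measurable_coord.
- by move=> t _; exact: f0.
- by move=> t _; exact: g0.
Qed.

Definition unit_cube : set Rd := [set x | forall i, (0 <= x ord0 i <= 1)%R].

Lemma measurable_box (a b : R) :
  measurable (row @^-1` [set x : Rd | forall i, (a <= x ord0 i <= b)%R]).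
Proof.
rewrite (_ : _ @^-1` _ = \bigcap_(i in setT) (fun t : d.-tuple T => tnth t i) @^-1` `[a, b]%classic); last first.
  apply/seteqP; split => t /= H i.
    by move=> _; have := H i; rewrite mxE /= in_itv.
  by have : tnth t i \in `[a, b]%R := H i I; rewrite mxE in_itv.
apply: fin_bigcap_measurable; first exact: finite_finset.
by move=> i _; rewrite -[X in measurable X]setTI; exact: measurable_tnth.
Qed.

Lemma measure_box (a b : R) : (a <= b)%R ->
  mu (row @^-1` [set x : Rd | forall i, (a <= x ord0 i <= b)%R]) = ((b - a) ^+ d)%:E.
Proof.
move=> ab; rewrite -lebesgue_tuple_cube//; congr (mu _).
by apply/seteqP; split => t /= H i; have := H i; rewrite mxE.
Qed.

Let cube : Rd -> \bar R := EFin \o \1_unit_cube.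

Let mcube : rowmeas cube.
Proof.
rewrite /rowmeas (_ : cube \o row = EFin \o \1_(row @^-1` unit_cube)).
  by apply/measurable_EFinP/measurable_indicP; exact: measurable_box.
by apply/funext => t; rewrite /= !indicE.
Qed.

Let cube0 x : 0 <= cube x. Proof. by rewrite lee_fin indicE. Qed.

Let integral_cube : \int[mu]_t cube (row t) = 1.
Proof.
transitivity (\int[mu]_t (\1_(row @^-1` unit_cube) t)%:E).
  by apply: eq_integral => t _; rewrite /cube /= !indicE.
rewrite integral_indic//; last exact: measurable_box.
by rewrite setIT; have := @measure_box 0 1 ler01; rewrite subr0 expr1n.
Qed.

Let rowmeas_mulmx (f : Rd -> \bar R) M : rowmeas f -> rowmeas (fun x => f (x *m M)).
Proof.
by move=> mf; apply: (measurable_row_comp mf); apply: measurable_coord_mulmx measurable_coord.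
Qed.

(** With the indicator of the unit cube for [f], [haar_swap] exhibits [c] as the integral of the
    transformed indicator. The constants of [M] and of its inverse have product 1, so [c] is
    positive and finite. *)
Lemma ge0_integral_row_mulmx (M : 'M[R]_d) : M \in unitmx ->
  exists2 c : R, (0 < c)%R & forall g : Rd -> \bar R, rowmeas g -> (forall x, 0 <= g x) ->
    \int[mu]_t g (row t *m M) = c%:E * \int[mu]_t g (row t).
Proof.
have key M' : M' \in unitmx -> forall g : Rd -> \bar R, rowmeas g -> (forall x, 0 <= g x) ->
    \int[mu]_t g (row t *m M') = (\int[mu]_t cube (row t *m M')) * \int[mu]_t g (row t).
  move=> uM' g mg g0; have := haar_swap uM' mcube cube0 mg g0.
  by rewrite integral_cube mul1e => <-; rewrite muleC.
move=> uM; set c := \int[mu]_t cube (row t *m M).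
set c' := \int[mu]_t cube (row t *m invmx M).
have c0 : 0 <= c by exact: integral_ge0.
have c'0 : 0 <= c' by exact: integral_ge0.
have cc' : c * c' = 1.
  rewrite /c' -(key _ uM (fun x => cube (x *m invmx M)))//; last exact: rowmeas_mulmx.
  rewrite -integral_cube; apply: eq_integral => t _.
  by rewrite mulmxK.
(* An infinite [c] is excluded: its product with [c'] would be 0 or infinite. *)
have [r cr] : exists r, c = r%:E.
  case: (c) c0 cc' => [r _ _|_|//]; first by exists r.
  move: c'0; rewrite le_eqVlt => /predU1P[<-|c'0].
    by rewrite mule0 => /eqP; rewrite eqe eq_sym oner_eq0.
  by rewrite gt0_mulye.
exists r; last by rewrite -cr; exact: key.
rewrite lt_neqAle -lee_fin -cr c0 andbT; apply/eqP => r0.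
by move: cc'; rewrite cr -r0 mul0e => /eqP; rewrite eqe eq_sym oner_eq0.
Qed.

(** Changing variables twice gives [c ^ 2 = 1], and [c] is positive. *)
Lemma ge0_integral_row_involution (M : 'M[R]_d) : M *m M = 1%:M ->
  forall g : Rd -> \bar R, rowmeas g -> (forall x, 0 <= g x) ->
    \int[mu]_t g (row t *m M) = \int[mu]_t g (row t).
Proof.
move=> MM g mg g0.
have [c c0 H] := ge0_integral_row_mulmx (mulmx1_unit MM).1.
suff c1 : c = 1%R by rewrite H// c1 mul1e.
have := integral_cube.
have -> : \int[mu]_t cube (row t) = \int[mu]_t cube (row t *m M *m M).
  by apply: eq_integral => t _; rewrite -mulmxA MM mulmx1.
rewrite (H (fun x => cube (x *m M)))//; last exact: rowmeas_mulmx.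
rewrite H// integral_cube mule1 -EFinM => -[]/eqP; rewrite -expr2 sqrf_eq1.
by move=> /orP[/eqP//|/eqP c1]; move: c0; rewrite c1 oppr_gt0 ltr10.
Qed.

End haar.

(** * Euclidean geometry and reflections *)

Section euclidean_geometry.
Context {R : realType} {d : nat}.
Implicit Types x y z e : 'rV[R]_d.

(** Written as a matrix product, so that bilinearity and orthogonal matrices are handled by matrix
    algebra. *)
Definition dot x y : R := (x *m y^T) ord0 ord0.

Lemma dotE x y : dot x y = \sum_i x ord0 i * y ord0 i.
Proof. by rewrite /dot mxE; apply: eq_bigr => i _; rewrite mxE. Qed.

Lemma dotC x y : dot x y = dot y x.
Proof. by rewrite !dotE; apply: eq_bigr => i _; rewrite mulrC. Qed.

Lemma dotDl x y z : dot (x + y) z = dot x z + dot y z.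
Proof. by rewrite /dot mulmxDl mxE. Qed.

Lemma dotDr x y z : dot z (x + y) = dot z x + dot z y.
Proof. by rewrite !(dotC z) dotDl. Qed.

Lemma dotZl a x y : dot (a *: x) y = a * dot x y.
Proof. by rewrite /dot -scalemxAl mxE. Qed.

Lemma dotZr a x y : dot x (a *: y) = a * dot x y.
Proof. by rewrite !(dotC x) dotZl. Qed.

Lemma dotNl x y : dot (- x) y = - dot x y.
Proof. by rewrite -scaleN1r dotZl mulN1r. Qed.

Lemma dotNr x y : dot x (- y) = - dot x y.
Proof. by rewrite !(dotC x) dotNl. Qed.

Definition dot_lin := (dotDl, dotDr, dotNl, dotNr, dotZl, dotZr).

Lemma dot_ge0 x : 0 <= dot x x.
Proof. by rewrite dotE sumr_ge0// => i _; rewrite -expr2 sqr_ge0. Qed.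

Lemma dot_eq0 x : (dot x x == 0) = (x == 0).
Proof.
apply/idP/eqP => [|->]; last by rewrite /dot mul0mx mxE.
rewrite dotE psumr_eq0 => [/allP x0|i _]; last by rewrite -expr2 sqr_ge0.
apply/rowP => i; rewrite mxE; apply/eqP.
by have := x0 i (mem_index_enum i); rewrite /= mulf_eq0 orbb.
Qed.

Lemma enorm_dot x : enorm x = Num.sqrt (dot x x).
Proof. by rewrite dotE /enorm; congr Num.sqrt; apply: eq_bigr => i _; rewrite expr2. Qed.

Lemma enorm_ge0 x : 0 <= enorm x. Proof. exact: sqrtr_ge0. Qed.

Lemma enorm_sq x : enorm x ^+ 2 = dot x x.
Proof. by rewrite enorm_dot sqr_sqrtr// dot_ge0. Qed.

Lemma enorm_eq0 x : (enorm x == 0) = (x == 0).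
Proof. by rewrite -dot_eq0 -enorm_sq sqrf_eq0. Qed.

Lemma enorm_gt0 x : (0 < enorm x) = (x != 0).
Proof. by rewrite lt_neqAle enorm_ge0 andbT eq_sym enorm_eq0. Qed.

Lemma enorm_le x y : (enorm x <= enorm y) = (dot x x <= dot y y).
Proof. by rewrite !enorm_dot ler_sqrt// dot_ge0. Qed.

Lemma enormZ a x : enorm (a *: x) = `|a| * enorm x.
Proof. by rewrite !enorm_dot dotZl dotZr mulrA -expr2 sqrtrM ?sqr_ge0// sqrtr_sqr. Qed.

Lemma enormN x : enorm (- x) = enorm x.
Proof. by rewrite -scaleN1r enormZ normrN1 mul1r. Qed.

(** Cauchy-Schwarz for a unit vector, from the nonnegative square of [x - (x.e) e]. *)
Lemma dot_unit_le x e : dot e e = 1 -> dot x e <= enorm x.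
Proof.
move=> e1; rewrite (le_trans (ler_norm _))// -(@ler_pXn2r _ 2)// ?nnegrE ?enorm_ge0//.
rewrite enorm_sq real_normK ?num_real//.
have := dot_ge0 (x - dot x e *: e); rewrite !dot_lin e1 (dotC e x); nra.
Qed.

Lemma coord_le_enorm x i : `|x ord0 i| <= enorm x.
Proof.
rewrite -(@ler_pXn2r _ 2)// ?nnegrE ?enorm_ge0// enorm_sq real_normK ?num_real//.
by rewrite dotE (bigD1 i)//= expr2 lerDl sumr_ge0// => j _; rewrite -expr2 sqr_ge0.
Qed.

Lemma coord_le_norm x i : `|x ord0 i| <= `|x|.
Proof. by rewrite [leRHS]/Num.norm /= mx_normrE; apply/bigmax_geP; right; exists (ord0, i). Qed.

Lemma norm_le_coord x M : 0 <= M -> (forall i, `|x ord0 i| <= M) -> `|x| <= M.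
Proof.
move=> M0 xM; rewrite [leLHS]/Num.norm /= mx_normrE; apply/bigmax_leP; split=> // -[i j] _.
by rewrite (ord1 i) xM.
Qed.

(* The reflection across the hyperplane [dot p e = c], for a unit vector [e]. *)
Definition reflmx e : 'M[R]_d := 1%:M - 2 *: (e^T *m e).

Definition refl e (c : R) x := x - (2 * (dot x e - c)) *: e.

Lemma mulmx_refl e x : x *m reflmx e = x - (2 * dot x e) *: e.
Proof.
rewrite mulmxBr mulmx1 -scalemxAr mulmxA; congr (_ - _).
rewrite -scalerA; congr (2 *: _).
by rewrite [x *m e^T]mx11_scalar mul_scalar_mx.
Qed.

Lemma reflE e c x : refl e c x = x *m reflmx e + (2 * c) *: e.
Proof. by rewrite mulmx_refl -addrA -scaleNr -scalerDl /refl -scaleNr; congr (_ + _ *: _); ring. Qed.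

Lemma dot_refl e c x : dot e e = 1 -> dot (refl e c x) e = 2 * c - dot x e.
Proof. by move=> e1; rewrite !dot_lin e1; ring. Qed.

Lemma reflK e c : dot e e = 1 -> involutive (refl e c).
Proof.
move=> e1 x.
have -> : refl e c (refl e c x) = refl e c x - (2 * (dot (refl e c x) e - c)) *: e by [].
rewrite dot_refl// /refl -addrA -!(scaleNr _ e) -scalerDl.
rewrite -[RHS]addr0 -(scale0r e); congr (_ + _ *: _); ring.
Qed.

Lemma reflmxK e : dot e e = 1 -> reflmx e *m reflmx e = 1%:M.
Proof.
move=> e1; apply/row_matrixP => i; rewrite !rowE mulmx1 mulmxA.
by rewrite -[RHS](reflK 0 e1) !reflE mulr0 scale0r !addr0.
Qed.

Lemma dot_mulmx_refl e x y : dot e e = 1 -> dot (x *m reflmx e) (y *m reflmx e) = dot x y.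
Proof. by move=> e1; rewrite !mulmx_refl !dot_lin e1 !(dotC e); ring. Qed.

Lemma enorm_mulmx_refl e x : dot e e = 1 -> enorm (x *m reflmx e) = enorm x.
Proof. by move=> e1; rewrite !enorm_dot dot_mulmx_refl. Qed.

Lemma refl_subl e c x y : refl e c (x + y) = refl e c x + y *m reflmx e.
Proof. by rewrite !reflE mulmxDl addrAC. Qed.

End euclidean_geometry.

(** * Maximum principles *)

Section kernel.
Context {R : realType} {d : nat}.
Local Notation T := (measurableTypeR R).
Local Notation Rd := 'rV[R]_d.
Local Notation mu := (@lebesgue_tuple R d).
Local Notation row := (@row_of_tuple R d).
Implicit Types (w f : Rd -> R) (x y z : Rd).

Definition ker z : R := (enorm z ^+ d.+1)^-1.

Lemma ker_ge0 z : 0 <= ker z.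
Proof. by rewrite invr_ge0 exprn_ge0// enorm_ge0. Qed.

Lemma ker_le z z' : 0 < enorm z -> enorm z <= enorm z' -> ker z' <= ker z.
Proof.
move=> z0 zz'; have z'0 := lt_le_trans z0 zz'.
by rewrite lef_pV2 ?posrE ?exprn_gt0// lerXn2r// nnegrE enorm_ge0.
Qed.

Lemma kerN z : ker (- z) = ker z. Proof. by rewrite /ker enormN. Qed.

Lemma rowmeas_ker : @rowmeas R d _ R ker.
Proof.
rewrite /rowmeas (_ : _ \o _ = fun t =>
    (((\sum_i row t ord0 i ^+ 2) `^ 2^-1) ^+ d.+1) `^ (-1)); last first.
  apply/funext => t /=; rewrite powR_inv1 ?exprn_ge0 ?powR_ge0//.
  by rewrite powR12_sqrt// sumr_ge0// => i _; rewrite sqr_ge0.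
apply: (@measurableT_comp _ _ _ _ R R (@powR R ^~ (-1))); first exact: measurable_powR.
apply: measurable_funX.
apply: (@measurableT_comp _ _ _ _ R R (@powR R ^~ 2^-1)); first exact: measurable_powR.
by apply: measurable_sum => i; apply: measurable_funX; exact: measurable_coord.
Qed.

Lemma rowmeas_affine (s : R) v f : @rowmeas R d _ R f -> @rowmeas R d _ R (fun x => f (s *: x + v)).
Proof.
move=> mf; apply: (measurable_row_comp mf).
apply: measurable_coordD; last by move=> i; exact: measurable_cst.
move=> i; rewrite (_ : (fun _ => _) = (fun t => s * row t ord0 i)); last first.
  by apply/funext => t; rewrite mxE.
by apply: (@measurable_funM _ _ R) => //; exact: measurable_coord.
Qed.

(** The vanishing of the half Laplacian, without its positive normalizing constant. *)
Definition null_second_difference f x :=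
  mu.-integrable setT (fun t => (half_laplacian_kernel f x (row t))%:E) /\
  (\int[mu]_t (half_laplacian_kernel f x (row t))%:E = 0)%E.

(* [w (y + z) - w y] is split into the gain [g] and the loss [h]; a measure
   preserving [tau] that carries the loss below the gain prevents the integral
   of the second difference of [w] from vanishing. *)
Lemma gain_loss_not_null w y (tau : Rd -> Rd) (C M : R) :
  (0 < d)%N -> @rowmeas R d _ R w -> w y < 0 ->
  (forall i, @measurable_fun _ _ (d.-tuple T) T setT (fun t => tau (row t) ord0 i)) ->
  (forall g : Rd -> \bar R, rowmeas g -> (forall x, 0 <= g x)%E ->
    \int[mu]_t g (tau (row t)) = \int[mu]_t g (row t))%E ->
  let g z := Num.max (w (y + z) - w y) 0 * ker z in
  let h z := Num.max (w y - w (y + z)) 0 * ker z in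
  (forall z, h (tau z) <= g z) -> (forall z, h z <= C) ->
  (forall z, M < `|z| -> w (y + z) = 0 /\ h (tau z) = 0) ->
  ~ null_second_difference w y.
Proof.
move=> d0 mw wy0 mtau tauP g h htau hC far [F_int F0].
have mwy : @rowmeas R d _ R (fun z => w (y + z)).
  apply: (measurable_row_comp mw); apply: measurable_coordD; last exact: measurable_coord.
  by move=> i; exact: measurable_cst.
have mg : @rowmeas R d _ R g.
  apply: (@measurable_funM _ _ R); last exact: rowmeas_ker.
  by apply: (@measurable_maxr _ _ R) => //; apply: (@measurable_funB _ _ R).
have mh : @rowmeas R d _ R h.
  apply: (@measurable_funM _ _ R); last exact: rowmeas_ker.
  by apply: (@measurable_maxr _ _ R) => //; apply: (@measurable_funB _ _ R).
have g0 z : 0 <= g z by rewrite mulr_ge0 ?ker_ge0// le_max lexx orbT.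
have h0 z : 0 <= h z by rewrite mulr_ge0 ?ker_ge0// le_max lexx orbT.
(* The second difference is the loss minus the gain, each summed over [z] and [- z]; both signs have
   the same integral. *)
have kerE z : half_laplacian_kernel w y z = (h z + h (- z)) - (g z + g (- z)).
  rewrite /half_laplacian_kernel /h /g kerN -/(ker z).
  rewrite -!mulrDl -mulrBl; congr (_ * _).
  have E a b : a - b = Num.max (a - b) 0 - Num.max (b - a) 0 :> R.
    by rewrite /Num.max; case: ltrP => ?; case: ltrP => ?; lra.
  by rewrite mulrDl mul1r; have := E (w y) (w (y + z)); have := E (w y) (w (y - z)); lra.
have mhN : @rowmeas R d _ R (fun z => h (- z)).
  by have := rowmeas_affine (-1) 0 mh; under eq_fun do rewrite scaleN1r addr0.
have mgN : @rowmeas R d _ R (fun z => g (- z)).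
  by have := rowmeas_affine (-1) 0 mg; under eq_fun do rewrite scaleN1r addr0.
have intN (f : Rd -> R) : @rowmeas R d _ R f -> (forall x, 0 <= f x) ->
    (\int[mu]_t (f (- row t))%:E = \int[mu]_t (f (row t))%:E)%E.
  move=> mf f0.
  rewrite -(@ge0_integral_row_affine R d (-1) 0 (EFin \o f)).
  - by apply: eq_integral => t _; rewrite scaleN1r addr0.
  - by rewrite sqrrN expr1n.
  - exact/measurable_EFinP.
  - by move=> x; rewrite lee_fin.
have C0 : 0 <= C by exact: le_trans (hC 0).
pose M' := Num.max M 0.
(* The loss is at most [C] and vanishes outside a cube, so it is integrable and may be
   subtracted. *)
have hfin : (\int[mu]_t (h (row t))%:E < +oo)%E.
  pose B : set Rd := [set x | forall i, - M' <= x ord0 i <= M'].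
  apply: (@le_lt_trans _ _ (\int[mu]_t (C * \1_(row @^-1` B) t)%:E)%E).
    apply: ge0_le_integral => //.
    - by move=> t _; rewrite lee_fin.
    - exact/measurable_EFinP.
    - apply/measurable_EFinP; apply: (@measurable_funM _ _ R) => //.
      by apply/measurable_indicP; exact: measurable_box.
    - move=> t _; rewrite lee_fin indicE; case: (boolP (t \in _)) => tB.
        by rewrite mulr1.
      rewrite mulr0; have far_t : M < `|row t|.
        rewrite ltNge; apply: contraNN tB => tM; rewrite inE => i /=.
        by rewrite -ler_norml (le_trans (coord_le_norm _ i))// le_max tM.
      rewrite /h (far _ far_t).1 subr0 (max_idPr _) ?mul0r//; exact: ltW.
  under eq_integral do rewrite EFinM.
  rewrite ge0_integralZl//; last first.
    by apply/measurable_EFinP/measurable_indicP; exact: measurable_box.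
  rewrite integral_indic//; last exact: measurable_box.
  rewrite setIT [X in (_ * X)%E]measure_box; last by rewrite ge0_cp// le_max lexx orbT.
  by rewrite -EFinM ltry.
have mEh : measurable_fun setT (fun t => (h (row t))%:E) by exact/measurable_EFinP.
have mEg : measurable_fun setT (fun t => (g (row t))%:E) by exact/measurable_EFinP.
have mEhN : measurable_fun setT (fun t => (h (- row t))%:E) by exact/measurable_EFinP.
have mEgN : measurable_fun setT (fun t => (g (- row t))%:E) by exact/measurable_EFinP.
have h0' z : (0 <= (h z)%:E)%E by rewrite lee_fin.
have g0' z : (0 <= (g z)%:E)%E by rewrite lee_fin.
have hint : mu.-integrable setT (fun t => (h (row t))%:E).
  by apply/integrableP; split=> //; under eq_integral do rewrite gee0_abs//.
have hNint : mu.-integrable setT (fun t => (h (- row t))%:E).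
  by apply/integrableP; split=> //; under eq_integral do rewrite gee0_abs//; rewrite intN.
(* A null second difference makes the total gain equal to the total loss; the next claim contradicts
   this. *)
have hg : (\int[mu]_t (g (row t))%:E = \int[mu]_t (h (row t))%:E)%E.
  have : (\int[mu]_t ((g (row t))%:E + (g (- row t))%:E) =
      \int[mu]_t ((h (row t))%:E + (h (- row t))%:E))%E.
    rewrite -[RHS]sube0 -F0 -integralB//; last exact: integrableD.
    apply: eq_integral => t _; rewrite kerE -!EFinD; congr EFin; ring.
  rewrite !ge0_integralD// !intN//.
  set Ig := (\int[mu]_t _)%E; set Ih := (\int[mu]_t _)%E.
  have : Ih \is a fin_num by exact: integrable_fin_num.
  have : (0 <= Ig)%E by exact: integral_ge0.
  case: Ih => // r; case: Ig => // s _ _.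
  by rewrite -!EFinD => -[] sr; congr EFin; lra.
have [dl dl0 gain] : exists2 dl : R, 0 < dl & (\int[mu]_t (h (row t))%:E + dl%:E <=
    \int[mu]_t (g (row t))%:E)%E.
  (* On this cube of volume 1, [w (y + z)] and the transported loss vanish, so the gain is at least
     [- w y / q ^ d.+1], where [q] bounds the Euclidean norm on the cube. *)
  pose B : set Rd := [set x | forall i, M' + 1 <= x ord0 i <= M' + 2].
  pose q : R := Num.sqrt (d%:R * (M' + 2) ^+ 2).
  have M'0 : 0 <= M' by rewrite le_max lexx orbT.
  have Bfar z : B z -> M < `|z|.
    move=> Bz; rewrite (lt_le_trans _ (coord_le_norm z (Ordinal d0)))//.
    have /andP[zi _] := Bz (Ordinal d0); rewrite (lt_le_trans _ (ler_norm _))//.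
    by rewrite (lt_le_trans _ zi)// ltr_pwDr// le_max lexx.
  have Bnorm z : B z -> 0 < enorm z <= q.
    move=> Bz; apply/andP; split.
      rewrite (lt_le_trans _ (coord_le_enorm z (Ordinal d0)))// normr_gt0.
      have /andP[zi _] := Bz (Ordinal d0); rewrite gt_eqF//; lra.
    rewrite /enorm ler_sqrt; last by apply: mulr_ge0; rewrite ?ler0n ?sqr_ge0.
    have -> : d%:R * (M' + 2) ^+ 2 = \sum_(i < d) (M' + 2) ^+ 2.
      by rewrite sumr_const card_ord mulr_natl.
    apply: ler_sum => i _.
    have /andP[zi1 zi2] := Bz i; rewrite ler_sqr ?nnegrE//; lra.
  exists (- w y * (q ^+ d.+1)^-1).
    rewrite mulr_gt0 ?oppr_gt0// invr_gt0 exprn_gt0//.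
    have /Bnorm/andP[] : B (const_mx (M' + 1)); last exact: lt_le_trans.
    by move=> i; rewrite mxE; lra.
  set dl := - w y * _.
  have dl0 : 0 <= dl by rewrite mulr_ge0 ?oppr_ge0 ?(ltW wy0)// invr_ge0 exprn_ge0// sqrtr_ge0.
  rewrite -(tauP (EFin \o h))//=.
  have -> : dl%:E = (\int[mu]_t (dl * \1_(row @^-1` B) t)%:E)%E.
    under eq_integral do rewrite EFinM.
    rewrite ge0_integralZl//; last first.
      by apply/measurable_EFinP/measurable_indicP; exact: measurable_box.
    rewrite integral_indic//; last exact: measurable_box.
    rewrite setIT [X in (_ * X)%E]measure_box; last by rewrite lerD2l ler1n.
       by rewrite (_ : _ - _ = 1) ?expr1n ?mule1//; ring.
  have mhtau : measurable_fun setT (fun t => (h (tau (row t)))%:E).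
    exact/measurable_EFinP/(measurable_row_comp mh).
  have mB : measurable_fun setT (fun t => (dl * \1_(row @^-1` B) t)%:E).
    apply/measurable_EFinP; apply: (@measurable_funM _ _ R) => //.
    by apply/measurable_indicP; exact: measurable_box.
  have B0 t : (0 <= (dl * \1_(row @^-1` B) t)%:E)%E by rewrite lee_fin mulr_ge0// indicE.
  rewrite -ge0_integralD//; apply: ge0_le_integral => //.
  - by move=> t _; rewrite adde_ge0.
  - exact: emeasurable_funD.
  move=> t _; rewrite -EFinD lee_fin indicE; case: (boolP (t \in _)) => [|_].
    rewrite inE => Bt; have [wt ->] := far _ (Bfar _ Bt).
    rewrite add0r mulr1 /g wt sub0r (max_idPl _) ?oppr_ge0 ?(ltW wy0)//.
    rewrite ler_wpM2l ?oppr_ge0 ?(ltW wy0)//.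
    have /andP[t0 tq] := Bnorm _ Bt; have q0 := lt_le_trans t0 tq.
    by rewrite lef_pV2 ?posrE ?exprn_gt0// lerXn2r// nnegrE ltW.
  by rewrite mulr0 addr0.
move: gain; rewrite hg.
have : (\int[mu]_t (h (row t))%:E)%E \is a fin_num by exact: integrable_fin_num.
by case: (\int[mu]_t _)%E => // r _; rewrite -EFinD lee_fin; lra.
Qed.

End kernel.

(** * Invariance of null second differences under similarities, and two maximum principles *)

Section maximum_principles.
Context {R : realType} {d : nat}.
Local Notation T := (measurableTypeR R).
Local Notation Rd := 'rV[R]_d.
Local Notation mu := (@lebesgue_tuple R d).
Local Notation row := (@row_of_tuple R d).
Implicit Types (w f g : Rd -> R) (x y z e : Rd).

Lemma null_second_differenceB f g x :
  null_second_difference f x -> null_second_difference g x ->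
  null_second_difference (fun p => f p - g p) x.
Proof.
move=> [fi f0] [gi g0].
have kerB z : half_laplacian_kernel (fun p => f p - g p) x z =
    half_laplacian_kernel f x z - half_laplacian_kernel g x z.
  by rewrite /half_laplacian_kernel -mulrBl; congr (_ / _); ring.
split.
  apply: eq_integrable (integrableB measurableT fi gi) => // t _.
  by rewrite kerB EFinB.
by under eq_integral do rewrite kerB EFinB; rewrite integralB// f0 g0 sube0.
Qed.

(** The kernel is homogeneous of degree [-(d+1)], so the second difference of [f \o A] at [x] is
    [s ^ d.+1] times that of [f] at [A x], composed with [M]. The linear change of variables keeps
    its integral zero. *)
Lemma null_second_difference_similar f x (A : Rd -> Rd) (M : 'M[R]_d) (s : R) :
  0 < s -> M \in unitmx -> (forall z, enorm (z *m M) = s * enorm z) ->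
  (forall z z', A (z + z') = A z + z' *m M) ->
  null_second_difference f (A x) -> null_second_difference (f \o A) x.
Proof.
move=> s0 uM Ms AM [Fi F0]; pose F z := half_laplacian_kernel f (A x) z.
have kerA z : half_laplacian_kernel (f \o A) x z = s ^+ d.+1 * F (z *m M).
  rewrite /F /half_laplacian_kernel /= !AM mulNmx Ms exprMn invfM.
  by rewrite [RHS]mulrCA mulVKf// expf_neq0// gt_eqF.
have [c c0 cM] := ge0_integral_row_mulmx uM.
have mF : measurable_fun setT (fun t => (F (row t))%:E) by case/integrableP : Fi.
have mFM : measurable_fun setT (fun t => (F (row t *m M))%:E).
  apply: (measurable_row_comp (f := EFin \o F)) => //.
  by apply: measurable_coord_mulmx; exact: measurable_coord.
have FMi : mu.-integrable setT (fun t => (F (row t *m M))%:E).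
  apply/integrableP; split => //.
  rewrite (cM (fun z => `|(F z)%:E|%E))//; last exact: measurableT_comp.
  by rewrite lte_mul_pinfty ?lee_fin ?(ltW c0)//; case/integrableP : Fi.
(* The change of variables holds for nonnegative functions, so it is applied to the positive and
   negative parts. *)
have posE : ((fun t => (F (row t))%:E)^\+ = (EFin \o F)^\+ \o row)%E := funepos_comp _ _.
have negE : ((fun t => (F (row t))%:E)^\- = (EFin \o F)^\- \o row)%E := funeneg_comp _ _.
have FM0 : (\int[mu]_t (F (row t *m M))%:E = 0)%E.
  rewrite integralE; transitivity (\int[mu]_t (EFin \o F)^\+ (row t *m M) -
    \int[mu]_t (EFin \o F)^\- (row t *m M))%E.
    by congr (_ - _)%E; apply: eq_integral => t _; rewrite ?funeposE ?funenegE.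
  rewrite (cM (EFin \o F)^\+)%E; last 2 first.
  - by rewrite /rowmeas -funepos_comp; exact: (measurable_funepos mF).
  - by move=> z; exact: funepos_ge0.
  rewrite (cM (EFin \o F)^\-)%E; last 2 first.
  - by rewrite /rowmeas -funeneg_comp; exact: (measurable_funeneg mF).
  - by move=> z; exact: funeneg_ge0.
  rewrite -muleBr//; last first.
    by have := integrable_add_def measurableT Fi; rewrite posE negE.
  by rewrite (_ : (_ - _)%E = 0%E) ?mule0// -F0 [RHS]integralE posE negE.
split.
  apply: eq_integrable (integrableZl measurableT (s ^+ d.+1) FMi) => // t _.
  by rewrite kerA EFinM.
by under eq_integral do rewrite kerA EFinM; rewrite integralZl// FM0 mule0.
Qed.

(* Here the loss [h] vanishes. *)
Lemma null_min_ge0 w y (M : R) : (0 < d)%N -> @rowmeas R d _ R w ->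
  (forall p, M < `|p| -> w p = 0) -> (forall p, w y <= w p) ->
  null_second_difference w y -> 0 <= w y.
Proof.
move=> d0 mw wfar wmin; case: ltP => // wy0 null; exfalso.
have lossE p : Num.max (w y - w p) 0 = 0 by apply/max_idPr; rewrite subr_le0.
apply: (@gain_loss_not_null R d w y id 0 (M + `|y|)) null => //.
- exact: measurable_coord.
- by move=> z; rewrite lossE mul0r mulr_ge0 ?ker_ge0// le_max lexx orbT.
- by move=> z; rewrite lossE mul0r.
- move=> z zM; split; last by rewrite /= lossE mul0r.
  by apply: wfar; rewrite addrC (lt_le_trans _ (lerB_normD _ _))// ltrBrDr.
Qed.

(** A loss occurs only beyond the hyperplane, at the reflection of some [p] on the side of [y].
    There [w p >= - w (refl e c p)] and [w y < 0] make the gain at [p] at least that loss, and [p]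
    is no farther from [y] than its reflection. *)
Lemma antisymmetric_min_ge0 w e c y (M B : R) : (0 < d)%N -> @rowmeas R d _ R w ->
  dot e e = 1 ->
  (forall p, M < `|p| -> w p = 0 /\ w (refl e c p) = 0) ->
  (forall p, - B <= w p) ->
  dot y e <= c -> (forall p, dot p e <= c -> w y <= w p) ->
  (forall p, 0 <= w p + w (refl e c p)) ->
  null_second_difference w y -> 0 <= w y.
Proof.
move=> d0 mw e1 wfar wB yc wmin wanti; case: ltP => // wy0 null; exfalso.
(* On the hyperplane [y] would be its own reflection, and [wanti] would give [0 <= 2 * w y]. *)
have {}yc : dot y e < c.
  rewrite lt_neqAle yc andbT; apply/eqP => yc'.
  have := wanti y; have -> : refl e c y = y by rewrite /refl yc' subrr mulr0 scale0r subr0.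
  by apply/negP; rewrite -ltNge; lra.
pose tau z := refl e c (y + z) - y.
have ytau z : y + tau z = refl e c (y + z) by rewrite addrC subrK.
have tauE z : tau z = z *m reflmx e + (refl e c y - y).
  by rewrite /tau refl_subl addrAC addrC.
have loss0 p : dot p e <= c -> Num.max (w y - w p) 0 = 0.
  by move=> pc; apply/max_idPr; rewrite subr_le0; exact: wmin.
pose rho := c - dot y e; have rho0 : 0 < rho by rewrite subr_gt0.
(* A loss occurs only at distance at least [rho] from [y], which bounds the kernel there; the lower
   bound [- B] on [w] bounds the difference. *)
apply: (@gain_loss_not_null R d w y tau (`|w y + B| * (rho ^+ d.+1)^-1) (M + `|y|)) null => //.
- move=> i; rewrite (_ : (fun _ => _) =
    fun t => (row t *m reflmx e + (refl e c y - y)) ord0 i); last first.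
    by apply/funext => t; rewrite tauE.
  apply: measurable_coordD; last by move=> j; exact: measurable_cst.
  by apply: measurable_coord_mulmx; exact: measurable_coord.
- move=> g mg g0.
  rewrite -[RHS](ge0_integral_row_involution (reflmxK e1) mg g0).
  rewrite -[RHS](@ge0_integral_row_affine R d 1 ((refl e c y - y) *m reflmx e)
    (fun z => g (z *m reflmx e)))//.
  + by apply: eq_integral => t _; rewrite scale1r mulmxDl -mulmxA reflmxK// mulmx1 tauE.
  + by rewrite expr1n.
  + by apply: (measurable_row_comp mg); apply: measurable_coord_mulmx; exact: measurable_coord.
- move=> z; rewrite ytau; have [zc|zc] := leP (dot (y + z) e) c; last first.
    rewrite loss0 ?mul0r ?mulr_ge0 ?ker_ge0// ?le_max ?lexx ?orbT//.
    by rewrite dot_refl//; lra.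
  (* At [z = 0] the kernel has the default value 0, so [ker_le] does not apply; there the loss at
     the reflection of [y] vanishes, since [w (refl e c y) >= - w y > w y]. *)
  have [->|z0] := eqVneq z 0.
    rewrite addr0; have -> : Num.max (w y - w (refl e c y)) 0 = 0.
      by apply/max_idPr; have := wanti y; lra.
    by rewrite mul0r mulr_ge0 ?ker_ge0// le_max lexx orbT.
  apply: ler_pM; rewrite ?ker_ge0 ?le_max ?lexx ?orbT//.
    apply/orP; left; rewrite ge_max.
    by have := wanti (y + z); have := wmin _ zc; lra.
  apply: ker_le; first by rewrite enorm_gt0.
  (* [|tau z|^2 - |z|^2] is 4 times the product of [(y + z).e - c] and [y.e - c], which are both
     nonpositive. *)
  have -> : tau z = z - (2 * (dot (y + z) e - c)) *: e.
    by rewrite /tau /refl; set v := _ *: e; rewrite (addrC y) -!addrA (addrCA y) subrr addr0.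
  rewrite enorm_le; move: zc; rewrite !dot_lin e1 !(dotC e).
  set p := dot y e in yc *; set q := dot z e => zc.
  have : 0 <= (p + q - c) * (p - c) by apply: mulr_le0; lra.
  by move=> pc; lra.
- move=> z; have [zc|zc] := leP (dot (y + z) e) c.
    by rewrite loss0// mul0r mulr_ge0// invr_ge0 exprn_ge0// ltW.
  have rz : rho <= enorm z.
    by rewrite (le_trans _ (dot_unit_le z e1))// /rho; move: zc; rewrite dotDl; lra.
  apply: ler_pM; rewrite ?ker_ge0 ?le_max ?lexx ?orbT//.
    rewrite ge_max normr_ge0 andbT (le_trans _ (ler_norm _))//.
    by have := wB (y + z); lra.
  by rewrite lef_pV2 ?posrE ?exprn_gt0// ?(lt_le_trans rho0)// lerXn2r// nnegrE ?enorm_ge0// ltW.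
- move=> z zM; have zM' : M < `|y + z|.
    by rewrite addrC (lt_le_trans _ (lerB_normD _ _))// ltrBrDr.
  have [-> wr] := wfar _ zM'; split=> //.
  by rewrite ytau wr subr0 (max_idPr _) ?mul0r// ltW.
Qed.

End maximum_principles.

(** * The Gamma function *)

Section gamma.
Context {R : realType}.
Local Notation leb := (@lebesgue_measure R).

(** For [t > 1], raise [1 + v <= exp v] at [v = t / (2 (n+1))] to the power [n+1]; for [t <= 1] the
    summand 1 suffices. *)
Lemma powR_le_expR_half (a t : R) (n : nat) : 0 <= a -> a <= n.+1%:R -> 0 < t ->
  t `^ a <= (1 + (2 * n.+1%:R) ^+ n.+1) * expR (t / 2).
Proof.
move=> a0 an t0; have [t1|t1] := leP t 1.
  apply: (@le_trans _ _ 1); first by rewrite (le_trans (ge0_ler_powR a0 _ _ t1))// ?nnegrE ?(ltW t0)// powR1.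
  rewrite -[leLHS]mulr1 ler_pM// ?lerDl ?exprn_ge0//.
  by rewrite -[leLHS]expR0 ler_expR; lra.
apply: (@le_trans _ _ (t ^+ n.+1)).
  by rewrite -powR_mulrn ?(ltW t0)// ler_powR// ltW.
rewrite mulrDl mul1r ler_wpDl ?expR_ge0//.
have -> : t / 2 = n.+1%:R * (t / (2 * n.+1%:R)).
  by rewrite [RHS]mulrCA; congr (_ * _); rewrite invfM mulrCA mulfV ?mulr1// pnatr_eq0.
rewrite expRM_natl -exprMn lerXn2r ?nnegrE ?(ltW t0) ?mulr_ge0 ?expR_ge0//.
rewrite mulrC -ler_pdivrMr ?mulr_gt0 ?ltr0n//.
by apply: le_trans (expR_ge1Dx _); rewrite lerDr.
Qed.

(** The integral must be finite as well as positive, since [fine] sends [+oo] to 0. The exponential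
    density of rate 1/2, times [C], dominates the integrand, which is at least [exp (-2)] on
    [[1, 2]]. *)
Lemma Gamma_gt0 (s : R) : 1 <= s -> 0 < Gamma s.
Proof.
move=> s1; have s0 : 0 <= s - 1 by rewrite subr_ge0.
pose f t : R := t `^ (s - 1) * expR (- t).
pose D := `]0, +oo[%classic : set (measurableTypeR R).
have mD : measurable D by exact: measurable_itv.
have f0 t : 0 <= f t by rewrite mulr_ge0 ?powR_ge0 ?expR_ge0.
have mf : measurable_fun setT f.
  apply: measurable_funM; first exact: measurable_powR.
  by apply: (@measurableT_comp _ _ _ _ R R expR) => //; exact: measurable_funN.
have mEf : measurable_fun D (fun t => (f t)%:E).
  by apply/measurable_EFinP; exact: measurable_funTS.
have [n sn] : exists n, s - 1 <= n.+1%:R.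
  by exists (Num.bound (s - 1)); rewrite (le_trans (ltW (archi_boundP s0)))// ler_nat.
pose C : R := (1 + (2 * n.+1%:R) ^+ n.+1) * 2.
have C0 : 0 <= C by rewrite mulr_ge0// addr_ge0// exprn_ge0.
have fin : (\int[leb]_(t in D) (f t)%:E < +oo)%E.
  apply: (@le_lt_trans _ _ (\int[leb]_t (C%:E * (exponential_pdf 2^-1 t)%:E))%E).
    have mpdf : measurable_fun setT (fun t => (C%:E * (exponential_pdf 2^-1 t)%:E)%E).
      by apply: emeasurable_funM => //; apply/measurable_EFinP; exact: measurable_exponential_pdf.
    have pdf0 t : (0 <= C%:E * (exponential_pdf (2^-1 : R) t)%:E)%E.
      by rewrite mule_ge0 ?lee_fin// exponential_pdf_ge0.
    apply: (@le_trans _ _ (\int[leb]_(t in D) (C%:E * (exponential_pdf 2^-1 t)%:E))%E); last first.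
      by apply: ge0_subset_integral.
    apply: ge0_le_integral => //.
    - by move=> t _; rewrite lee_fin.
    - by apply: measurable_funTS.
    move=> t; rewrite /D /= in_itv/= andbT => t0; rewrite -EFinM lee_fin.
    rewrite exponential_pdfE ?(ltW t0)// /f.
    have /(ler_wpM2r (expR_ge0 (- t))) := powR_le_expR_half s0 sn t0.
    move=> /le_trans; apply; rewrite /C -!mulrA ler_wpM2l//.
      by rewrite mulrA mulfV// mul1r -expRD ler_expR; lra.
  rewrite ge0_integralZl//; last 2 first.
  - by apply/measurable_EFinP; exact: measurable_exponential_pdf.
  - by move=> t _; rewrite lee_fin exponential_pdf_ge0.
  by rewrite integral_exponential_pdf// mule1 ltry.
have pos : ((expR (-2))%:E <= \int[leb]_(t in D) (f t)%:E)%E.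
  apply: (@le_trans _ _ (\int[leb]_(t in `[1%R, 2%R]) (f t)%:E)%E).
    have -> : (expR (-2))%:E = (\int[leb]_(t in `[1%R, 2%R]) (expR (-2))%:E)%E.
      rewrite integral_cst// [X in (_ * X)%E]lebesgue_measure_itv/= lte_fin ltr1n -EFinD.
      by rewrite (_ : 2 - 1 = 1 :> R) ?mule1//; ring.
    apply: ge0_le_integral => //.
    - by apply/measurable_EFinP; exact: measurable_funTS.
    move=> t /=; rewrite in_itv/= => /andP[t1 t2]; rewrite lee_fin -[leLHS]mul1r ler_pM ?expR_ge0//.
      by rewrite (le_trans _ (ler_powR t1 s0))// powRr0.
    by rewrite ler_expR lerN2.
  apply: ge0_subset_integral => //.
  - by move=> t _; rewrite lee_fin.
  - by move=> t; rewrite /D /= !in_itv/= andbT => /andP[t1 _]; exact: lt_le_trans t1.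
rewrite /Gamma /Rintegral -/D; change (0 < fine (\int[leb]_(t in D) (f t)%:E)).
rewrite fine_gt0// fin andbT (lt_le_trans _ pos)// lte_fin expR_gt0//.
Qed.

End gamma.

(** * Convex hulls and separation *)

Section convex_hull.
Local Open Scope convex_scope.
Context {R : realType} {d : nat}.
Local Notation Rd := 'rV[R]_d.
Implicit Types (A : set Rd) (p q x y : Rd).

Definition combination A n p := exists (a : 'I_n -> R) (Y : 'I_n -> Rd),
  [/\ forall i, 0 <= a i, \sum_i a i = 1, forall i, A (Y i) & p = \sum_i a i *: Y i].

Lemma combination_drop A n (a : 'I_n.+1 -> R) (Y : 'I_n.+1 -> Rd) i :
  (forall i, 0 <= a i) -> \sum_i a i = 1 -> (forall i, A (Y i)) -> a i = 0 ->
  combination A n (\sum_i a i *: Y i).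
Proof.
move=> a0 a1 AY ai0; exists (a \o lift i), (Y \o lift i); split => //=.
- by rewrite -a1 [RHS](bigD1_ord i)//= ai0 add0r.
- by rewrite (bigD1_ord i)//= ai0 scale0r add0r.
Qed.

(** Appending a coordinate 1 puts the points in R^(d+1), where more than [d+1] vectors are
    dependent; the extra coordinate records the sum of the coefficients. *)
Lemma affine_dependence n (Y : 'I_n -> Rd) : (d.+1 < n)%N ->
  exists b : 'I_n -> R, [/\ exists i, 0 < b i, \sum_i b i = 0 & \sum_i b i *: Y i = 0].
Proof.
move=> dn; pose M : 'M[R]_(n, d + 1) := \matrix_i row_mx (Y i) (const_mx 1).
have : kermx M != 0.
  rewrite kermx_eq0 -row_leq_rank -ltnNge (leq_ltn_trans (rank_leq_col _))//.
  by rewrite addn1.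
move=> /rowV0Pn[v /sub_kermxP vM v0].
have vME : row_mx (\sum_i v ord0 i *: Y i) (const_mx (\sum_i v ord0 i)) = 0 :> 'rV[R]_(d + 1).
  rewrite -vM mulmx_sum_row; under [RHS]eq_bigr do rewrite rowK scale_row_mx.
  apply/rowP => k; rewrite summxE !mxE; case: (fintype.split k) (splitK k) => l kl.
    by rewrite summxE; apply: eq_bigr => i _; rewrite -kl row_mxEl.
  by rewrite mxE; apply: eq_bigr => i _; rewrite -kl row_mxEr !mxE mulr1.
have [sY s1] : \sum_i v ord0 i *: Y i = 0 /\ \sum_i v ord0 i = 0.
  move: vME; rewrite -row_mx0 => /eq_row_mx[-> /matrixP/(_ ord0 ord0)].
  by rewrite !mxE.
have [i vi] : exists i, v ord0 i != 0.
  apply/not_existsP => H; move/eqP : v0; apply; apply/rowP => i; rewrite mxE.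
  by apply/eqP/negPn/negP; exact: H.
(* Nonpositive coefficients with sum 0 would all vanish. *)
have [[j vj]|Hneg] := pselect (exists i, 0 < v ord0 i).
  by exists (fun i => v ord0 i); split=> //; exists j.
exfalso; have le0 k : 0 <= - v ord0 k.
  by rewrite oppr_ge0 leNgt; apply/negP => vk; apply: Hneg; exists k.
have /psumr_eq0P : \sum_i (- v ord0 i) = 0 by rewrite sumrN s1 oppr0.
by move=> /(_ (fun k _ => le0 k) i isT)/eqP; rewrite oppr_eq0; exact/negP.
Qed.

(** Subtract the largest multiple of an affine dependence that keeps the weights nonnegative: the
    index minimizing [a i / b i] over [b i > 0] loses its weight. *)
Lemma combination_reduce A n p : (d.+1 <= n)%N -> combination A n.+1 p -> combination A n p.
Proof.
move=> dn [a [Y [a0 a1 AY ->]]].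
have [b [[j bj] b1 bY]] := affine_dependence Y dn.
pose i := [arg min_(i < j | 0 < b i) (a i / b i)]%O.
have [bi imin] : 0 < b i /\ forall k, 0 < b k -> a i / b i <= a k / b k.
  by rewrite /i; case: arg_minP.
pose t := a i / b i; have t0 : 0 <= t by rewrite divr_ge0// ltW.
have -> : \sum_i a i *: Y i = \sum_i (a i - t * b i) *: Y i.
  under [RHS]eq_bigr do rewrite scalerBl -scalerA.
  by rewrite sumrB -scaler_sumr bY scaler0 subr0.
apply: (@combination_drop A n (fun i => a i - t * b i) Y i) => //.
- move=> k; rewrite subr_ge0; have [bk|bk] := ltP 0 (b k).
    by rewrite -ler_pdivlMr//; exact: imin.
  by rewrite (le_trans _ (a0 k))// mulr_ge0_le0.
- by rewrite sumrB -mulr_sumr b1 mulr0 subr0.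
- by rewrite /t divfK ?gt_eqF// subrr.
Qed.

Lemma caratheodory A n p : combination A n p ->
  exists2 k, (k <= d)%N & combination A k.+1 p.
Proof.
elim: n => [[a [Y [_ + _ _]]]|n IHn Cp].
  by rewrite big_ord0 => /esym/eqP; rewrite oner_eq0.
by have [dn|nd] := leqP d.+1 n; [apply: IHn; exact: combination_reduce|exists n].
Qed.

(** Iterated joins by segments: for compact [A] each is a continuous image of a compact set, and [d]
    steps give the convex hull. *)
Fixpoint iter_segments n A : set Rd :=
  if n is n'.+1 then
    (fun tpq : R * (Rd * Rd) => (1 - tpq.1) *: tpq.2.1 + tpq.1 *: tpq.2.2) @`
      (`[0, 1] `*` (iter_segments n' A `*` A))
  else A.

Lemma compact_iter_segments n A : compact A -> compact (iter_segments n A).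
Proof.
move=> cA; elim: n => [//|n IHn]; apply: continuous_compact; last first.
  by apply: compact_setX; [exact: segment_compact|exact: compact_setX].
apply: continuous_subspaceT => tpq; apply: cvgD; apply: cvgZ.
- by apply: cvgB; [exact: cvg_cst|exact: cvg_fst].
- exact: (@continuous_comp _ _ _ snd fst tpq cvg_snd cvg_fst).
- exact: cvg_fst.
- exact: (@continuous_comp _ _ _ snd snd tpq cvg_snd cvg_snd).
Qed.

Lemma iter_segmentsS n A p : iter_segments n A p -> iter_segments n.+1 A p.
Proof.
move=> np; have [a Aa] : A !=set0.
  by elim: n p np => [|n IHn] p; [exists p|move=> [[t [q1 q2]] [_ [_ Aq]] _]; exists q2].
by exists (0, (p, a)) => /=; rewrite ?subr0 ?scale1r ?scale0r ?addr0// in_itv/= lexx ler01.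
Qed.

Lemma iter_segments_mono m n A p : (m <= n)%N -> iter_segments m A p -> iter_segments n A p.
Proof.
move=> mn mp; rewrite -(subnK mn); elim: (n - m)%N => [//|k IHk].
by rewrite addSn; exact: iter_segmentsS.
Qed.

(** The last point, of weight [t], is joined to the combination of the others with weights divided
    by [1 - t]. *)
Lemma combination_iter_segments A n p : combination A n.+1 p -> iter_segments n A p.
Proof.
elim: n p => [p [a [Y [a0 a1 AY ->]]]|n IHn p [a [Y [a0 a1 AY ->]]]].
  by move: a1; rewrite !big_ord1 => ->; rewrite scale1r.
rewrite big_ord_recr /=; move: a1; rewrite big_ord_recr /=.
set t := a ord_max => a1.
(* For [t = 1] no renormalization is possible, but all other weights vanish. *)
have [t1|t1] := eqVneq t 1.
  have : \sum_(i < n.+1) a (widen_ord (leqnSn n.+1) i) = 0.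
    by move: a1; rewrite t1 => /(canRL (addrK 1)); rewrite subrr.
  move=> /psumr_eq0P => H; rewrite big1; last first.
    by move=> i _; rewrite H ?scale0r.
  rewrite t1 add0r scale1r; exact: (@iter_segments_mono 0 n.+1 A (Y ord_max) (leq0n _) (AY _)).
have tlt : t < 1.
  rewrite lt_neqAle t1 -a1 lerDr; exact: sumr_ge0.
have t0 : 1 - t != 0 by rewrite subr_eq0 eq_sym.
exists (t, (\sum_(i < n.+1) (a (widen_ord (leqnSn n.+1) i) / (1 - t)) *:
    Y (widen_ord (leqnSn n.+1) i), Y ord_max)) => /=; last first.
  rewrite scaler_sumr; congr (_ + _); apply: eq_bigr => i _.
  by rewrite scalerA mulrC divfK.
split; first by rewrite /= in_itv/= a0 ltW.
split; last exact: AY.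
apply: IHn; exists (fun i => a (widen_ord (leqnSn n.+1) i) / (1 - t)).
exists (fun i => Y (widen_ord (leqnSn n.+1) i)); split => //.
- by move=> i; rewrite divr_ge0// subr_ge0 ltW.
- by rewrite -mulr_suml (canRL (addrK t) a1) mulfV.
Qed.

(** The finite combinations form a convex set containing [A]: two families are concatenated, with
    weights scaled by [l] and [1 - l]. *)
Lemma convex_hull_combination A p : convex_hull A p -> exists n, combination A n p.
Proof.
pose U : set Rd := [set q | exists n, combination A n q].
move=> /(_ U) H; apply: H; split => [|q Aq]; last first.
  exists 1%N, (fun=> 1), (fun=> q); split=> //; first by rewrite big_ord1.
  by rewrite big_ord1 scale1r.
move=> x y l; rewrite !inE => -[n [a [Y [a0 a1 AY ->]]]] [m [b [Z [b0 b1 AZ ->]]]].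
exists (n + m)%N.
exists (fun i => match fintype.split i with inl j => l%:num * a j | inr k => (1 - l%:num) * b k end).
exists (fun i => match fintype.split i with inl j => Y j | inr k => Z k end).
have l0 : 0 <= l%:num by [].
have l1 : 0 <= 1 - l%:num by rewrite subr_ge0.
have splitl j : fintype.split (lshift m j) = inl j :> 'I_n + 'I_m := unsplitK (inl j).
have splitr k : fintype.split (rshift n k) = inr k :> 'I_n + 'I_m := unsplitK (inr k).
split.
- by move=> i; case: fintype.split => j; rewrite mulr_ge0.
- rewrite big_split_ord/=; under eq_bigr do rewrite splitl.
  under [X in _ + X]eq_bigr do rewrite splitr.
  by rewrite -!mulr_sumr a1 b1 !mulr1 addrC subrK.
- by move=> i; case: fintype.split.
- rewrite big_split_ord/=; under [in RHS]eq_bigr do rewrite splitl -scalerA.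
  under [X in _ = _ + X]eq_bigr do rewrite splitr -scalerA.
  by rewrite -!scaler_sumr.
Qed.

Lemma convex_hull_segment A p q (t : R) : 0 <= t <= 1 ->
  convex_hull A p -> convex_hull A q -> convex_hull A ((1 - t) *: p + t *: q).
Proof.
move=> t01 hp hq B [cB AB].
have Bp : B p by exact: hp. have Bq : B q by exact: hq.
have /andP[t0 t1] := t01.
have h0 : 0 <= 1 - t by rewrite subr_ge0.
have h1 : 1 - t <= 1 by rewrite gerBl.
have := cB p q (Itv01 h0 h1) (mem_set Bp) (mem_set Bq); rewrite inE.
suff -> : (1 - t) *: p + t *: q = (p : convex_lmodType Rd) <| Itv01 h0 h1 |> q by [].
by rewrite -[X in _ + X *: q](subKr 1 t).
Qed.

Lemma iter_segments_convex_hull A n : iter_segments n A `<=` convex_hull A.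
Proof.
elim: n => [p Ap B [_]|n IHn p]; first exact.
move=> [[t [q1 q2]] [/= + [/IHn h1 Aq2]] <-]; rewrite in_itv/= => t01.
by apply: convex_hull_segment => // B [_]; exact.
Qed.

Lemma compact_convex_hull A : compact A -> compact (convex_hull A).
Proof.
move=> cA; rewrite (_ : convex_hull A = iter_segments d A); first exact: compact_iter_segments.
apply/seteqP; split => [p|]; last exact: iter_segments_convex_hull.
move=> /convex_hull_combination[n /caratheodory[k kd /combination_iter_segments]].
exact: iter_segments_mono.
Qed.

End convex_hull.

(** * Separation of a ray from a convex hull *)

Section separation.
Context {R : realType} {d : nat}.
Local Notation Rd := 'rV[R]_d.
Implicit Types (A : set Rd) (p q x y e n : Rd).

Lemma dot_continuous e : continuous (fun q : Rd => dot q e).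
Proof.
rewrite (_ : (fun q => _) = (fun q : Rd => \sum_i q ord0 i * e ord0 i)); last first.
  by apply/funext => q; rewrite dotE.
move=> q; apply: (cvg_big add_continuous (F := nbhs q)) => i _.
by apply: cvgM; [exact: coord_continuous|exact: cvg_cst].
Qed.

Lemma sqdist_continuous x : continuous (fun q : Rd => dot (q - x) (q - x)).
Proof.
rewrite (_ : (fun q => _) =
    (fun q : Rd => \sum_i (q ord0 i - x ord0 i) * (q ord0 i - x ord0 i))); last first.
  by apply/funext => q; rewrite dotE; apply: eq_bigr => i _; rewrite !mxE.
move=> q; apply: (cvg_big add_continuous (F := nbhs q)) => i _.
by apply: cvgM; apply: cvgB; [exact: coord_continuous|exact: cvg_cst
  |exact: coord_continuous|exact: cvg_cst].
Qed.

(* The squared distance from [q] to the ray [x + t n], [t >= 0], is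
   [|q - x|^2 - max(0, (q - x).n)^2]; the separating direction starts at a
   point of the hull which minimizes it. *)
Lemma ray_separation A x n : compact A -> A !=set0 -> dot n n = 1 ->
  (forall t, 0 <= t -> ~ convex_hull A (x + t *: n)) ->
  exists e, [/\ dot e e = 1, 0 < dot n e & forall y, A y -> dot y e <= dot x e].
Proof.
move=> cA [a0 Aa0] n1 noray.
have AC : A `<=` convex_hull A by move=> p Ap B [_]; exact.
(* [x + s q *: n] is the point of the ray nearest to [q]. *)
pose s q := Num.max (dot (q - x) n) 0.
pose f q := dot (q - x) (q - x) - s q ^+ 2.
have s0 q : 0 <= s q by rewrite le_max lexx orbT.
have s1 q : dot (q - x) n <= s q by rewrite le_max lexx.
have s2 q : s q * (s q - dot (q - x) n) = 0.
  by rewrite /s /Num.max; case: ifP => _; rewrite ?mul0r// subrr mulr0.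
have dist q t : dot (x + t *: n - q) (x + t *: n - q) =
    dot (q - x) (q - x) - 2 * t * dot (q - x) n + t ^+ 2.
  have -> : x + t *: n - q = t *: n - (q - x) by rewrite opprB addrCA addrA.
  by rewrite !dot_lin n1 !(dotC n); ring.
have cf : continuous f.
  move=> q.
  have cs : s p @[p --> q] --> s q.
    have cx : {for q, continuous (fun q => dot (q - x) n)}.
      rewrite (_ : (fun q => _) = (fun q => dot q n + dot (- x) n)); last first.
        by apply/funext => p; rewrite dotDl.
      exact: (cvgD (@dot_continuous n q) (cvg_cst _)).
    have c0 : {for q, continuous (fun=> 0 : R^o)} by exact: (@cst_continuous Rd R^o 0 q).
    exact: (@continuous_max _ _ (fun q => dot (q - x) n) (fun=> 0) q cx c0).
  exact: (cvgB (@sqdist_continuous x q) (cvgM cs cs)).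
have [q0 + fmin] := compact_EVT_min (ex_intro _ a0 (AC _ Aa0))
  (compact_convex_hull cA) (continuous_subspaceT cf).
rewrite inE => Cq0; have [e eE] : exists e, e = x + s q0 *: n - q0 by eexists.
have ee : dot e e = f q0.
  by rewrite eE dist /f; have := s2 q0; lra.
have ee0 : 0 < dot e e.
  rewrite lt_neqAle dot_ge0 andbT eq_sym dot_eq0; apply/eqP => e0.
  by apply: (noray (s q0)) => //; move/eqP : e0; rewrite eE subr_eq0 => /eqP ->.
(* First-order optimality of [q0]: otherwise a step [th] toward [y], with [th * (w.w + w.e) = w.e],
   would come closer to the ray. *)
have ey y : convex_hull A y -> dot (y - q0) e <= 0.
  move=> Cy; have [w wE] : exists w, w = y - q0 by eexists.
  rewrite -wE leNgt; apply/negP => we.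
  pose th := dot w e / (dot w w + dot w e).
  have den : 0 < dot w w + dot w e by rewrite ltr_wpDl// dot_ge0.
  have th0 : 0 < th by rewrite divr_gt0.
  have thE : th * (dot w w + dot w e) = dot w e by rewrite divfK// gt_eqF.
  have th1 : th <= 1 by rewrite ler_pdivrMr// mul1r lerDr dot_ge0.
  pose q := (1 - th) *: q0 + th *: y.
  have Cq : convex_hull A q by apply: convex_hull_segment; rewrite // (ltW th0).
  have qE : x + s q0 *: n - q = e - th *: w.
    rewrite /q eE wE scalerBl scale1r scalerBr -[RHS]addrA -opprD.
    by congr (_ - _); rewrite addrAC addrA.
  have : f q <= dot (e - th *: w) (e - th *: w).
    have sa : 0 <= s q - dot (q - x) n by rewrite subr_ge0 s1.
    rewrite -qE dist /f; have := mulr_ge0 (s0 q0) sa; have := sqr_ge0 (s q0 - s q); lra.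
  have := fmin q; rewrite !inE => /(_ Cq).
  rewrite -ee !dot_lin !(dotC e) => h1 h2.
  have h3 : 0 < th * dot w e by rewrite mulr_gt0.
  have h4 : 0 < th * (th * dot w e) by exact: mulr_gt0.
  have h5 : th * (th * (dot w w + dot w e)) = th * dot w e by rewrite thE.
  by lra.
have [yM _ yMmax] := compact_EVT_max (ex_intro _ a0 Aa0) cA
  (continuous_subspaceT (@dot_continuous n)).
(* [e] may be orthogonal to [n], so it is tilted by [eps *: n]. Since [m] exceeds [(y - x).n] on
   [A], the tilt costs at most [eps * m = e.e], the gap between [x.e] and [q0.e]. *)
pose m := `|dot yM n - dot x n| + 1.
have m0 : 0 < m by rewrite ltr_wpDl.
pose eps := dot e e / m; have eps0 : 0 < eps by rewrite divr_gt0.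
have em : eps * m = dot e e by rewrite divfK// gt_eqF.
pose e' := e + eps *: n.
have ne : 0 < dot n e'.
  rewrite dotDr dotZr n1 mulr1 ltr_wpDl// eE !dot_lin n1 !(dotC n).
  by have := s1 q0; rewrite !dot_lin; lra.
have e'0 : 0 < enorm e'.
  by rewrite enorm_gt0; apply/eqP => e'0; move: ne; rewrite e'0 dotC /dot mul0mx mxE ltxx.
exists ((enorm e')^-1 *: e'); split.
- by rewrite dotZl dotZr -enorm_sq expr2 mulKf ?mulVf// gt_eqF.
- by rewrite dotZr mulr_gt0// invr_gt0.
move=> y Ay; rewrite !dotZr ler_wpM2l ?invr_ge0 ?enorm_ge0//.
have := ey _ (AC _ Ay); have := yMmax y; rewrite !inE => /(_ Ay) yM1.
have : dot q0 e = dot x e - dot e e.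
  have ne0 : dot n e = s q0 - dot (q0 - x) n.
    by rewrite eE !dot_lin n1 !(dotC n); ring.
  have -> : q0 = x + s q0 *: n - e by rewrite eE opprB addrCA subrr addr0.
  by rewrite 2!dotDl dotNl dotZl ne0 s2 addr0.
have := ler_norm (dot yM n - dot x n); move: em; rewrite /m.
rewrite !dot_lin; set D := `|_|; nra.
Qed.

End separation.

(** * Normals of graphs *)

Section normal.
Context {R : realType}.

Lemma partial_increment n (g : 'rV[R]_n -> R) (p : 'rV[R]_n) (i : 'I_n) (s c eps : R) :
  continuous g -> (forall x, derivable g x (delta_mx ord0 i)) ->
  (forall th, `|th| <= `|s| -> `|'D_(delta_mx ord0 i) g (p + th *: delta_mx ord0 i) - c| <= eps) ->
  `|g (p + s *: delta_mx ord0 i) - g p - s * c| <= eps * `|s|.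
Proof.
move=> cg dg Dc; set e := delta_mx ord0 i in dg Dc *.
pose phi (th : R) := g (p + th *: e).
have dphi (th : R) : is_derive th 1 phi ('D_e g (p + th *: e)).
  have E : (fun h : R => h^-1 *: ((phi \o shift th) (h *: 1) - phi th)) =
           (fun h : R => h^-1 *: ((g \o shift (p + th *: e)) (h *: e) - g (p + th *: e))).
    apply/funext => h; rewrite /phi /= /shift /=; congr (_ *: (g _ - _)).
    by rewrite scalerDl [h *: 1]mulr1 addrCA addrA.
  by split; rewrite ?/derivable ?/derive E //; exact: dg.
have cphi : continuous phi.
  move=> th; apply: differentiable_continuous; apply/derivable1_diffP.
  by case: (dphi th).
have cw a b : {within `[a, b], continuous phi} by apply: continuous_subspaceT.
have [s0|s0|->] := ltgtP s 0; last first.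
- by rewrite scale0r addr0 subrr mul0r subrr normr0 mulr0.
- have [th] := MVT s0 (fun x _ => dphi x) (cw 0 s).
  rewrite in_itv/= => /andP[th0 ths]; rewrite /phi scale0r addr0 subr0 => ->.
  rewrite mulrC -mulrBr normrM mulrC ler_wpM2r//; apply: Dc.
  by rewrite !gtr0_norm// ltW.
- have [th] := MVT s0 (fun x _ => dphi x) (cw s 0).
  rewrite in_itv/= => /andP[ths th0]; rewrite /phi scale0r addr0 sub0r => E.
  have -> : g (p + s *: e) - g p = s * 'D_e g (p + th *: e).
    by apply: oppr_inj; rewrite opprB E mulrN mulrC.
  rewrite -mulrBr normrM mulrC ler_wpM2r//; apply: Dc.
  by rewrite !ltr0_norm// lerN2 ltW.
Qed.

(** Continuous partial derivatives give differentiability: pass from 0 to [p] one coordinate at a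
    time, with the mean value theorem for each move. In the sup norm the intermediate points stay in
    the ball of radius [del]. *)
Lemma class_C1_differentiable0 n (g : 'rV[R]_n -> R) (eps : R) : class_C 1 g -> 0 < eps ->
  exists2 del : R, 0 < del & forall p, `|p| < del ->
    `|g p - g 0 - dot p (\row_i 'D_(delta_mx ord0 i) g 0)| <= n%:R * eps * `|p|.
Proof.
move=> [cg dg] eps0; set c := \row_i _.
have [del del0 Dc] : exists2 del : R, 0 < del & forall q i, `|q| < del ->
    `|'D_(delta_mx ord0 i) g q - 'D_(delta_mx ord0 i) g 0| <= eps.
  pose P (i : 'I_n) : set 'rV[R]_n :=
    fun q => `|'D_(delta_mx ord0 i) g 0 - 'D_(delta_mx ord0 i) g q| < eps.
  have : \forall q \near (0 : 'rV[R]_n), forall i, P i q.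
    apply: (@filter_forall _ _ P _ (nbhs_filter _)) => i; rewrite /P; have [_ [cD _]] := dg i.
    by have /cvgrPdist_lt := cD 0; exact.
  move=> /nbhs_ballP[del /= del0 H]; exists del => // q i qdel.
  by rewrite distrC ltW//; apply: H; rewrite -ball_normE /= sub0r normrN.
exists del => // p pdel.
pose pk k : 'rV[R]_n := \row_i (if (i < k)%N then p ord0 i else 0).
have pk_lt (q : 'rV[R]_n) : (forall i, `|q ord0 i| <= `|p ord0 i|) -> `|q| < del.
  move=> qp; apply: le_lt_trans pdel; apply: norm_le_coord => // i.
  by rewrite (le_trans (qp i))// coord_le_norm.
suff H k : (k <= n)%N -> `|g (pk k) - g 0 - dot (pk k) c| <= k%:R * eps * `|p|.
  have := H n (leqnn n); rewrite (_ : pk n = p)//.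
  by apply/rowP => i; rewrite mxE ltn_ord.
elim: k => [_|k IHk kn].
  rewrite (_ : pk 0 = 0); last by apply/rowP => i; rewrite !mxE.
  by rewrite subrr /dot mul0mx mxE subrr normr0 !mul0r.
pose i := Ordinal kn; pose s := p ord0 i.
have pkS : pk k.+1 = pk k + s *: delta_mx ord0 i.
  apply/rowP => j; rewrite !mxE eqxx /= ltnS leq_eqVlt -(inj_eq val_inj) /=.
  case: eqVneq => [jk|_] /=; last by rewrite mulr0 addr0.
  by rewrite jk ltnn add0r mulr1 /s; congr (p _ _); exact: val_inj.
have -> : g (pk k.+1) - g 0 - dot (pk k.+1) c =
    (g (pk k + s *: delta_mx ord0 i) - g (pk k) - s * c ord0 i) +
    (g (pk k) - g 0 - dot (pk k) c).
  rewrite pkS dotDl dotZl; have -> : dot (delta_mx ord0 i) c = c ord0 i.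
    by rewrite dotC /dot trmx_delta -colE mxE.
  by ring.
rewrite -natr1 !mulrDl mul1r [leRHS]addrC (le_trans (ler_normD _ _))// lerD//; last exact: IHk (ltnW kn).
apply: le_trans (_ : eps * `|s| <= _); last by rewrite ler_wpM2l ?(ltW eps0)// coord_le_norm.
apply: partial_increment => //; first by have [] := dg i.
move=> th ths; rewrite mxE; apply: Dc; apply: pk_lt => j; rewrite !mxE eqxx /=.
rewrite -(inj_eq val_inj) /=; case: eqVneq => [jk|_] /=.
  by rewrite jk ltnn add0r mulr1 (le_trans ths)// /s (_ : i = j)//; exact: val_inj.
by rewrite mulr0 addr0; case: ifP => // _; rewrite normr0.
Qed.

(** This is the height of the displacement [a] above the tangent plane of the graph. *)
Lemma dot_graph_normal d (j : 'I_d) (g : 'rV[R]_d.-1 -> R) w a :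
  dot a (graph_normal j g w) =
  a ord0 j - dot (col' j a) (\row_i 'D_(delta_mx ord0 i) g w).
Proof.
case: d => [|n] in j g w a *; first by case: j.
rewrite !dotE (bigD1_ord j)//= mxE unlift_none mulr1; congr (_ + _).
by rewrite -sumrN; apply: eq_bigr => i _; rewrite !mxE liftK mulrN.
Qed.

(** In the chart, [x + t v] lies above the graph by [t ((v Q).N) + o(t)], so the sign of [v.nu]
    decides whether the direction [v] enters or leaves [A]. *)
Lemma inward_unit_normalP d (A : set 'rV[R]_d) x nu :
  boundary A x -> inward_unit_normal A x nu ->
  [/\ dot nu nu = 1,
    forall v, 0 < dot v nu -> exists2 del : R, 0 < del & forall t, 0 < t < del -> A (x + t *: v) &
    forall v, dot v nu < 0 -> exists2 del : R, 0 < del & forall t, 0 < t < del -> ~ A (x + t *: v)].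
Proof.
move=> bx [rho [Q [j [g [g1 [rho0 QQ chart] nuE]]]]].
set N := graph_normal j g 0 in nuE; pose c := \row_i 'D_(delta_mx ord0 i) g 0.
have N_dot := dot_graph_normal j g 0.
have N0 : 0 < enorm N.
  rewrite enorm_gt0; apply/eqP => /rowP/(_ j); rewrite /N !mxE unlift_none.
  by move/eqP; rewrite oner_eq0.
(* As [x] is a boundary point, the chart puts the origin on the graph. *)
have gx : g 0 = 0.
  have : eball x rho x by rewrite /eball /= subrr enorm_dot /dot mul0mx mxE sqrtr0.
  move=> /chart; rewrite subrr mul0mx /= !mxE => -[_ [/(_ bx) -> _]].
  by congr g; apply/rowP => i; rewrite !mxE.
have nu_dot v : dot v nu = (enorm N)^-1 * dot (v *m Q) N.
  by rewrite nuE dotZr /dot trmx_mul trmxK mulmxA.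
have near0 v : dot (v *m Q) N != 0 -> exists2 del : R, 0 < del & forall t, 0 < t < del ->
    eball x rho (x + t *: v) /\
    `|g (t *: col' j (v *m Q)) - t * dot (col' j (v *m Q)) c| < t * `|dot (v *m Q) N|.
  set a := v *m Q; set b := col' j a; rewrite -normr_gt0; set eta := `|_| => eta0.
  (* With [eta / m] as precision, the remainder is at most [(d-1) (eta / m) t |b| < eta t]; the
     added 1 makes this strict and [m] positive. *)
  pose m : R := d.-1%:R * `|b| + 1.
  have m0 : 0 < m by rewrite ltr_wpDl// mulr_ge0.
  have [del1 del10 D1] := class_C1_differentiable0 g1 (divr_gt0 eta0 m0).
  exists (Num.min (rho / (enorm v + 1)) (del1 / (`|b| + 1))).
    by rewrite lt_min !divr_gt0// ltr_wpDl// enorm_ge0.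
  move=> t /andP[t0]; rewrite lt_min !ltr_pdivlMr ?ltr_wpDl ?enorm_ge0// => /andP[t1 t2].
  split.
    rewrite /eball /= addrAC subrr add0r enormZ gtr0_norm// (le_lt_trans _ t1)//.
    by rewrite ler_wpM2l ?(ltW t0)// lerDl.
  have tb : `|t *: b| < del1.
    by rewrite normrZ gtr0_norm// (le_lt_trans _ t2)// ler_wpM2l ?(ltW t0)// lerDl.
  have := D1 _ tb; rewrite gx subr0 dotZl => /le_lt_trans; apply.
  rewrite normrZ (gtr0_norm t0) mulrCA ltr_pM2l// mulrAC mulrA.
  by rewrite ltr_pdivrMr// mulrC ltr_pM2l// ltrDl.
have chart_t v t : eball x rho (x + t *: v) ->
    A (x + t *: v) <-> g (t *: col' j (v *m Q)) < t * (v *m Q) ord0 j.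
  move=> /chart; rewrite (addrC x) addrK -scalemxAl => -[H _].
  by move: H; rewrite linearZ [in X in _ <-> X]mxE.
split.
- rewrite nu_dot nuE -!scalemxAl -mulmxA (mulmx1C QQ) mulmx1 dotZl -enorm_sq.
  by rewrite expr2 mulrA mulVf ?gt_eqF// mul1r mulVf// gt_eqF.
- move=> v; rewrite nu_dot pmulr_rgt0 ?invr_gt0// => aN.
  have [|del del0 D] := near0 v; first by rewrite gt_eqF.
  exists del => // t tdel; have [xt] := D t tdel; rewrite (gtr0_norm aN) => gt.
  by apply/(chart_t _ _ xt); move: gt; rewrite N_dot mulrBr ltr_norml => /andP[_]; lra.
- move=> v; rewrite nu_dot pmulr_rlt0 ?invr_gt0// => aN.
  have [|del del0 D] := near0 v; first by rewrite lt_eqF.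
  exists del => // t tdel; have [xt] := D t tdel; rewrite (ltr0_norm aN) => gt.
  by move=> /(chart_t _ _ xt); move: gt; rewrite N_dot mulrN mulrBr ltr_norml => /andP[+ _]; lra.
Qed.

End normal.

(** * Comparison of the solution with its reflections *)

Section comparison.
Context {R : realType} {d : nat}.
Local Notation Rd := 'rV[R]_d.
Implicit Types (A K Omega : set Rd) (u w : Rd -> R) (p q x y e : Rd).

(** The normalizing constant is nonzero because Gamma is positive at [(d+1)/2 >= 1]; integrability
    makes the vanishing of [fine] that of the integral itself. *)
Lemma half_laplacian_eq0 u x : (0 < d)%N -> half_laplacian_eq u x 0 -> null_second_difference u x.
Proof.
move=> d0 [ui /eqP]; rewrite mulf_eq0 => /orP[|].
  rewrite mulf_eq0 invr_eq0 mulf_eq0 pnatr_eq0 /= [_ `^ _ == 0]gt_eqF ?powR_gt0 ?pi_gt0// orbF.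
  by rewrite gt_eqF// Gamma_gt0// ler_pdivlMr// mul1r ler_nat ltnS.
rewrite /Rintegral => /eqP H; split => //.
by rewrite -[LHS]fineK ?H//; exact: integrable_fin_num.
Qed.

Definition dilation x mu p : Rd := mu *: (p - x) + x.

Lemma dilationD x mu p v : dilation x mu (p + v) = dilation x mu p + mu *: v.
Proof. by rewrite /dilation addrAC scalerDr addrAC. Qed.

Lemma dilationM x mu nu p : dilation x mu (dilation x nu p) = dilation x (mu * nu) p.
Proof. by rewrite /dilation addrK scalerA. Qed.

Lemma dilation1 x p : dilation x 1 p = p.
Proof. by rewrite /dilation scale1r subrK. Qed.

Lemma dilation_continuous x mu : continuous (dilation x mu).
Proof.
by move=> p; exact: (cvgD (cvgZ (cvg_cst mu) (cvgB cvg_id (cvg_cst x))) (cvg_cst x)).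
Qed.

Lemma refl_continuous e c : continuous (@refl R d e c).
Proof.
move=> p; have dp := @dot_continuous R d e p.
have ds : {for p, continuous (fun q => 2 * (dot q e - c) : R)}.
  exact: (cvgM (cvg_cst (2 : R)) (cvgB dp (cvg_cst c))).
by apply: (cvgB cvg_id); apply: (cvgZ ds (cvg_cst e)).
Qed.

Lemma eball_nbhs x r : 0 < r -> nbhs x (eball x r).
Proof.
move=> r0; have := @sqdist_continuous R d x x.
have xx : dot (x - x) (x - x) = 0 by rewrite subrr /dot mul0mx mxE.
move=> /cvgrPdist_lt/(_ (r ^+ 2)); rewrite exprn_gt0// => /(_ isT).
apply: filterS => y; rewrite xx sub0r normrN ger0_norm ?dot_ge0// /eball /= -enorm_sq.
by rewrite ltr_pXn2r ?nnegrE ?enorm_ge0 ?ltW.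
Qed.

Lemma starshaped_dilation A x r mu p : 0 < r -> starshaped_wrt A (eball x r) ->
  0 <= mu <= 1 -> A p -> A (dilation x mu p).
Proof.
move=> r0 sA mu01 Ap; have [|_ /(_ mu mu01) H] := sA x.
  by rewrite /eball /= subrr enorm_dot /dot mul0mx mxE sqrtr0.
by apply: H; exists p.
Qed.

(** For [a] in [A] near [p], the dilation of [p] about [x] is also that of [a] about
    [xi = x + (mu / (1 - mu)) (p - a)], which still lies in the ball. *)
Lemma starshaped_closure_dilation A x r mu p : 0 < r -> starshaped_wrt A (eball x r) ->
  0 <= mu < 1 -> closure A p -> A (dilation x mu p).
Proof.
move=> r0 sA /andP[mu0 mu1] Ap.
have m0 : 0 < 1 - mu by rewrite subr_gt0.
have m1 : 0 < mu + 1 by rewrite ltr_wpDl.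
have eta0 : 0 < r * (1 - mu) / (mu + 1) by rewrite divr_gt0 ?mulr_gt0.
have [a [Aa]] := Ap _ (eball_nbhs p eta0); rewrite /eball /= => ap.
pose xi := x + (mu / (1 - mu)) *: (p - a).
have [|_ H] := sA xi.
  rewrite /eball /= /xi addrAC subrr add0r enormZ -(opprB a p) enormN.
  rewrite ger0_norm ?divr_ge0// ?(ltW m0)// mulrAC ltr_pdivrMr//.
  rewrite ltr_pdivlMr// in ap; apply: le_lt_trans ap.
  by rewrite mulrC ler_wpM2l ?enorm_ge0// lerDl.
have -> : dilation x mu p = mu *: (a - xi) + xi.
  apply/rowP => i; rewrite !mxE; field.
  by rewrite gt_eqF.
apply: (H mu); last by exists a.
by rewrite mu0 ltW.
Qed.

Lemma starshaped_closure A x r mu p : 0 < r -> starshaped_wrt A (eball x r) ->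
  0 <= mu <= 1 -> closure A p -> closure A (dilation x mu p).
Proof.
move=> r0 sA /andP[mu0]; rewrite le_eqVlt => /predU1P[-> Ap|mu1 Ap].
  by rewrite dilation1.
by apply: subset_closure; apply: starshaped_closure_dilation sA _ Ap => //; rewrite mu0.
Qed.

Lemma bounded_setP A : bounded_set A -> exists M, forall p, A p -> `|p| <= M.
Proof.
by move=> [M [_ H]]; exists (M + 1) => p Ap; apply: (H (M + 1)); rewrite ?ltrDl.
Qed.

Lemma closed_norm_le M : closed [set p : Rd | `|p| <= M].
Proof.
rewrite (_ : mkset _ = (fun p : Rd => `|p|) @^-1` [set t | t <= M])//.
apply: closed_comp; last exact: closed_le.
by move=> p _; exact: norm_continuous.
Qed.

Lemma bounded_norm_le M : bounded_set [set p : Rd | `|p| <= M].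
Proof.
by exists M; split; [exact: num_real|move=> y My p /= pM; exact: le_trans (ltW My)].
Qed.

Lemma bounded_setS A B : A `<=` B -> bounded_set B -> bounded_set A.
Proof. by move=> AB [M [Mr H]]; exists M; split=> // y My p /AB; exact: H. Qed.

Lemma bounded_closure A : bounded_set A -> bounded_set (closure A).
Proof.
move=> /bounded_setP[M AM]; apply: bounded_setS (bounded_norm_le M).
rewrite [X in _ `<=` X](closure_id _).1; last exact: closed_norm_le.
exact: closureS.
Qed.

(** [g] maps the closed ball of radius [M] to a bounded set, and [f] takes norms above [M] off this
    set. *)
Lemma continuous_far (f g : Rd -> Rd) M : continuous g -> cancel f g ->
  exists M', forall p, M' < `|p| -> M < `|f p|.
Proof.
move=> cg fg.
have /bounded_setP[M' H] : bounded_set (g @` [set p | `|p| <= M]).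
  apply: compact_bounded; apply: continuous_compact; first exact: continuous_subspaceT.
  by apply: bounded_closed_compact; [exact: bounded_norm_le|exact: closed_norm_le].
exists M' => p; rewrite !ltNge; apply: contra => pM; apply: H.
by exists (f p).
Qed.

Lemma continuous_min_far w (D : set Rd) M p : continuous w -> closed D ->
  (forall q, M < `|q| -> w q = 0) -> D p -> w p < 0 ->
  exists y, [/\ D y, w y < 0 & forall q, D q -> w y <= w q].
Proof.
move=> cw cD wM Dp wp.
have pM : `|p| <= M by rewrite leNgt; apply/negP => /wM wp0; move: wp; rewrite wp0 ltxx.
have cB : compact (D `&` [set q | `|q| <= M]).
  apply: bounded_closed_compact; last by apply: closedI => //; exact: closed_norm_le.
  by apply: bounded_setS (bounded_norm_le M) => q [].
have [y + ymin] := compact_EVT_min (ex_intro _ p (conj Dp pM)) cB (continuous_subspaceT cw).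
rewrite inE => -[Dy yM].
have wy : w y < 0 by apply: le_lt_trans wp; apply: ymin; rewrite inE.
exists y; split => // q Dq; have [qM|/wM ->] := leP `|q| M; last exact: ltW.
by apply: ymin; rewrite inE.
Qed.

End comparison.

(** * Monotonicity along dilations, comparison with reflections, and the scaling argument *)

Section bernoulli.
Context {R : realType} {d : nat} (d_gt0 : (0 < d)%N).
Local Notation Rd := 'rV[R]_d.
Context (K Omega : set Rd) (x0 : Rd) (r : R) (u : Rd -> R).
Context (r_gt0 : 0 < r) (K_star : starshaped_wrt K (eball x0 r))
  (Omega_star : starshaped_wrt Omega (eball x0 r))
  (Omega_open : open Omega) (Omega_bounded : bounded_set Omega)
  (u_continuous : continuous u) (u01 : forall x, 0 <= u x <= 1)
  (u_measurable : @rowmeas R d _ R u)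
  (u_harmonic : forall x, (Omega `\` closure K) x -> null_second_difference u x)
  (u_K : forall x, closure K x -> u x = 1) (u_Omega : forall x, ~ Omega x -> u x = 0).
Implicit Types (p q y e : Rd) (mu c : R).
Local Notation dil := (dilation x0).

Let u_ge0 p : 0 <= u p. Proof. by have /andP[] := u01 p. Qed.
Let u_le1 p : u p <= 1. Proof. by have /andP[] := u01 p. Qed.

Let u_pos p : 0 < u p -> Omega p.
Proof. by move=> up; apply: contrapT => /u_Omega up0; move: up; rewrite up0 ltxx. Qed.

Let x0_r : eball x0 r x0.
Proof. by rewrite /eball /= subrr enorm_dot /dot mul0mx mxE sqrtr0. Qed.

Let u_far (A B : Rd -> Rd) : continuous B -> cancel A B ->
  exists M, forall p, M < `|p| -> u (A p) = 0.
Proof.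
move=> cB AB; have [M0 OmegaM] := bounded_setP Omega_bounded.
have [M H] := continuous_far M0 cB AB; exists M => p /H.
by rewrite ltNge => pM; apply: u_Omega => /OmegaM; exact/negP.
Qed.

Let dilK mu : mu != 0 -> cancel (dil mu) (dil mu^-1).
Proof. by move=> mu0 p; rewrite dilationM mulVf// dilation1. Qed.

Let u_dil_null mu y : 0 < mu -> Omega (dil mu y) -> u (dil mu y) < 1 ->
  null_second_difference (u \o dil mu) y.
Proof.
move=> mu0 Oy uy; apply: (@null_second_difference_similar _ _ u y (dil mu) mu%:M mu) => //.
- by rewrite unitmxE det_scalar unitfE expf_neq0 ?gt_eqF.
- by move=> z; rewrite mul_mx_scalar enormZ gtr0_norm.
- by move=> z z'; rewrite dilationD mul_mx_scalar.
by apply: u_harmonic; split => // /u_K u1; move: uy; rewrite u1 ltxx.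
Qed.

Let u_dil_meas mu : @rowmeas R d _ R (u \o dil mu).
Proof.
have := rowmeas_affine mu (x0 - mu *: x0) u_measurable.
by congr rowmeas; apply/funext => p; rewrite /dilation /= scalerBr addrA addrAC.
Qed.

Let u_refl_meas e c : @rowmeas R d _ R (u \o refl e c).
Proof.
apply: (measurable_row_comp u_measurable) => i.
rewrite (_ : (fun _ => _) = fun t => (row_of_tuple t *m reflmx e + (2 * c) *: e) ord0 i); last first.
  by apply/funext => t; rewrite reflE.
apply: measurable_coordD; last by move=> j; exact: measurable_cst.
by apply: measurable_coord_mulmx; exact: measurable_coord.
Qed.

(** At a negative minimum [y] of [w], [u (dil mu y) < u y <= 1] and starshapedness place [y] and
    [dil mu y] in [Omega] and outside the closure of [K]. Both second differences are null there,
    and [null_min_ge0] applies. *)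
Lemma u_dilation mu p : 0 < mu <= 1 -> u p <= u (dil mu p).
Proof.
move=> /andP[mu0 mu1]; rewrite -subr_ge0 leNgt; apply/negP => wp.
have mu01 : 0 <= mu <= 1 by rewrite (ltW mu0).
pose w q := u (dil mu q) - u q.
have [M1 far1] := u_far (@dilation_continuous R d x0 mu^-1) (dilK (lt0r_neq0 mu0)).
have [M2 far2] := @u_far id id (fun _ => cvg_id) (fun _ => erefl).
pose M := Num.max M1 M2.
have wfar q : M < `|q| -> w q = 0.
  by rewrite gt_max => /andP[q1 q2]; rewrite /w far1// (far2 q)// subrr.
have cud : continuous (u \o dil mu).
  by move=> q; apply: continuous_comp; [exact: dilation_continuous|exact: u_continuous].
have cw : continuous w by move=> q; exact: (cvgB (cud q) (@u_continuous q)).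
have [y [_ wy wmin]] := @continuous_min_far R d w setT M p cw closedT wfar I wp.
have uy : u (dil mu y) < u y by rewrite -subr_lt0.
have Oy : Omega y by apply: u_pos; exact: le_lt_trans uy.
have Ody : Omega (dil mu y) by exact: (starshaped_dilation r_gt0 Omega_star mu01 Oy).
have ud1 : u (dil mu y) < 1 by exact: lt_le_trans uy _.
have : 0 <= w y; last by rewrite leNgt wy.
apply: (@null_min_ge0 R d w y M) => //.
- by apply: (@measurable_funB _ _ R) => //; exact: u_dil_meas.
- by move=> q; exact: wmin.
apply: null_second_differenceB; first exact: u_dil_null.
apply: u_harmonic; split => // Ky; move: ud1; rewrite u_K ?ltxx//.
exact: (starshaped_closure r_gt0 K_star mu01 Ky).
Qed.

(** By [antisymmetric_min_ge0] for [w]: regrouped, [w q + w (refl e c q)] is the sum of the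
    increments of [u] under the dilation at [q] and at its reflection, both nonnegative by
    [u_dilation]. *)
Lemma u_reflection e c mu p : dot e e = 1 -> (forall y, closure K y -> dot y e <= c) ->
  0 < mu <= 1 -> (forall q, Omega q -> c < dot q e -> Omega (dil mu (refl e c q))) ->
  dot p e <= c -> u (refl e c p) <= u (dil mu p).
Proof.
move=> e1 Kc mu01 Omu pc; rewrite -subr_ge0 leNgt; apply/negP => wp.
have /andP[mu0 mu1] := mu01.
pose w q := u (dil mu q) - u (refl e c q).
have cdil := @dilation_continuous R d x0 mu^-1.
have crefl := @refl_continuous R d e c.
have reflK' := @reflK R d e c e1.
have muK := dilK (lt0r_neq0 mu0).
have [M1 far1] := u_far cdil muK.
have [M2 far2] := u_far crefl reflK'.
have [M3 far3] := @u_far id id (fun _ => cvg_id) (fun _ => erefl).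
have [M4 far4] := @u_far (dil mu \o refl e c) (refl e c \o dil mu^-1)
  (fun q => continuous_comp (cdil q) (crefl _)) (can_comp muK reflK').
pose M := Num.max (Num.max M1 M2) (Num.max M3 M4).
have wfar q : M < `|q| -> w q = 0 /\ w (refl e c q) = 0.
  rewrite !gt_max => /andP[/andP[q1 q2] /andP[q3 q4]].
  by rewrite /w reflK' far1// far2// (far3 q)// (far4 q)// subrr.
have cud : continuous (u \o dil mu).
  by move=> q; apply: continuous_comp; [exact: dilation_continuous|exact: u_continuous].
have cur : continuous (u \o refl e c).
  by move=> q; apply: continuous_comp; [exact: crefl|exact: u_continuous].
have cw : continuous w by move=> q; exact: (cvgB (cud q) (cur q)).
have cD : closed [set q : Rd | dot q e <= c].
  rewrite (_ : mkset _ = (fun q : Rd => dot q e) @^-1` [set t | t <= c])//.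
  apply: closed_comp; last exact: closed_le.
  by move=> q _; exact: dot_continuous.
have [y [/= yc wy wmin]] := continuous_min_far cw cD (fun q h => (wfar q h).1) pc wp.
have uy : u (dil mu y) < u (refl e c y) by move: wy; rewrite /w; lra.
have Ory : Omega (refl e c y) by apply: u_pos; exact: le_lt_trans uy.
have {}yc : dot y e < c.
  rewrite lt_neqAle yc andbT; apply/eqP => yc'; move: uy.
  by rewrite /refl yc' subrr mulr0 scale0r subr0 ltNge u_dilation.
have ryc : c < dot (refl e c y) e by rewrite dot_refl//; lra.
(* The reflection of [y] lies in the cap, so [Omu] applies to it. *)
have Ody : Omega (dil mu y) by rewrite -(reflK' y); exact: Omu.
have ud1 : u (dil mu y) < 1 by exact: lt_le_trans uy _.
have : 0 <= w y; last by rewrite leNgt wy.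
apply: (@antisymmetric_min_ge0 R d w e c y M 1) => //.
- by apply: (@measurable_funB _ _ R); [exact: u_dil_meas|exact: u_refl_meas].
- by move=> q; rewrite /w; have := u_le1 (refl e c q); have := u_ge0 (dil mu q); lra.
- exact: ltW.
- move=> q; rewrite /w reflK'.
  by have := u_dilation q mu01; have := u_dilation (refl e c q) mu01; lra.
apply: null_second_differenceB; first exact: u_dil_null.
apply: (@null_second_difference_similar _ _ u y (refl e c) (reflmx e) 1) => //.
- by case/mulmx1_unit : (reflmxK e1).
- by move=> z; rewrite enorm_mulmx_refl// mul1r.
- exact: refl_subl.
by apply: u_harmonic; split => // /Kc; rewrite leNgt ryc.
Qed.

Lemma at_right_dist (f : R -> R) l eps : f t @[t --> 0^'+] --> l -> 0 < eps ->
  exists2 del : R, 0 < del & forall t, 0 < t < del -> `|l - f t| < eps.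
Proof.
move=> /cvgrPdist_lt fl /fl; rewrite near_withinE => /nbhs_ballP[del /= del0 H].
exists del => // t /andP[t0 tdel]; apply: H => //.
by rewrite /ball /= sub0r normrN gtr0_norm.
Qed.

(** Near [p] the reflection followed by the dilation sends [Omega] into [Omega], which forces the
    normals to correspond. Along them, a distance [t] at [p] becomes [t * mu] at the image, whence
    the factor [sqrt mu]. *)
Lemma no_touching_point e c mu lambda p : dot e e = 1 ->
  (forall y, closure K y -> dot y e <= c) -> 0 < lambda -> 0 < mu < 1 ->
  (forall q, Omega q -> c < dot q e -> Omega (dil mu (refl e c q))) ->
  boundary Omega p -> boundary Omega (dil mu (refl e c p)) -> c < dot p e ->
  half_normal_derivative Omega u p lambda ->
  half_normal_derivative Omega u (dil mu (refl e c p)) lambda -> False.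
Proof.
move=> e1 Kc lam0 /andP[mu0 mu1] Omu bp bq pc [nu1 n1 D1] [nu2 n2 D2].
set q := dil mu (refl e c p) in bq n2 D2.
have u_bd x : boundary Omega x -> u x = 0.
  by move=> [_ xO]; apply: u_Omega => Ox; apply: xO; move: Omega_open => /interior_id ->.
have shift t v : dil mu (refl e c (p + t *: v)) = q + (t * mu) *: (v *m reflmx e).
  by rewrite refl_subl dilationD -scalemxAl scalerA mulrC.
have pc_near v : exists2 del : R, 0 < del & forall t, 0 < t < del -> c < dot (p + t *: v) e.
  have den : 0 < `|dot v e| + 1 by rewrite ltr_wpDl.
  exists ((dot p e - c) / (`|dot v e| + 1)); first by rewrite divr_gt0// subr_gt0.
  move=> t /andP[t0]; rewrite ltr_pdivlMr// dotDl dotZl => H.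
  have : - (t * `|dot v e|) <= t * dot v e.
    by rewrite -mulrN ler_pM2l//; have := ler_norm (- dot v e); rewrite normrN; lra.
  by lra.
have [nu11 Pin _] := inward_unit_normalP bp n1.
have [nu21 _ Pout] := inward_unit_normalP bq n2.
have nuE : nu2 = nu1 *m reflmx e.
  have dotH v v' : dot (v *m reflmx e) v' = dot v (v' *m reflmx e).
    by rewrite -(dot_mulmx_refl v _ e1) -mulmxA reflmxK// mulmx1.
  (* A direction entering [Omega] at [p] is carried to one that cannot leave it at [q]: the open
     half-space of [nu1] lies in the closed half-space of the reflected [nu2]. *)
  have cone v : 0 < dot v nu1 -> 0 <= dot v (nu2 *m reflmx e).
    move=> vn; rewrite leNgt; apply/negP; rewrite -dotH => vn2.
    have [d1 d10 P1] := Pin _ vn; have [d2 d20 P2] := Pout _ vn2.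
    have [d3 d30 P3] := pc_near v.
    pose t := Num.min d1 (Num.min d2 d3) / 2.
    have m0 : 0 < Num.min d1 (Num.min d2 d3) by rewrite !lt_min d10 d20.
    have t0 : 0 < t by rewrite divr_gt0.
    have : t < Num.min d1 (Num.min d2 d3) by rewrite /t; lra.
    rewrite !lt_min => /and3P[t1 t2 t3].
    apply: (P2 (t * mu)); first by rewrite mulr_gt0//= (lt_trans _ t2)// gtr_pMr.
    by rewrite -shift; apply: Omu; [apply: P1; rewrite t0|apply: P3; rewrite t0].
  set nu' := nu2 *m reflmx e in cone.
  have nu'1 : dot nu' nu' = 1 by rewrite dot_mulmx_refl.
  (* If [nu1.nu' < 1], this vector has positive product with [nu1] and negative product with
     [nu']. *)
  have := cone (nu1 - nu'); rewrite !dot_lin nu11 nu'1 (dotC nu' nu1) => H.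
  have h1 : 1 <= dot nu1 nu'.
    by have [//|h] := leP 1 (dot nu1 nu'); have := H; rewrite !subr_ge0 subr_gt0 leNgt h => /(_ isT).
  have : dot (nu1 - nu') (nu1 - nu') == 0.
    by rewrite eq_le dot_ge0 andbT !dot_lin nu11 nu'1 (dotC nu' nu1); lra.
  rewrite dot_eq0 subr_eq0 => /eqP ->.
  by rewrite /nu' -mulmxA reflmxK// mulmx1.
have smu : Num.sqrt mu < 1 by rewrite -sqrtr1 ltr_sqrt.
have smu0 : 0 < Num.sqrt mu by rewrite sqrtr_gt0.
(* A quarter of the gap: the comparison will give [lambda (1 - sqrt mu) < eps (1 + sqrt mu) <= 2
   eps], against [4 eps]. *)
pose eps := lambda * (1 - Num.sqrt mu) / 4.
have eps0 : 0 < eps by rewrite divr_gt0// mulr_gt0// subr_gt0.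
have [d1 d10 P1] := at_right_dist D1 eps0.
have [d2 d20 P2] := at_right_dist D2 eps0.
have [d3 d30 P3] := pc_near nu1.
pose t := Num.min d1 (Num.min d2 d3) / 2.
have m0 : 0 < Num.min d1 (Num.min d2 d3) by rewrite !lt_min d10 d20.
have t0 : 0 < t by rewrite divr_gt0.
have : t < Num.min d1 (Num.min d2 d3) by rewrite /t; lra.
rewrite !lt_min => /and3P[t1 t2 t3].
have {}P1 := P1 t (introT andP (conj t0 t1)).
have tmu : 0 < t * mu < d2 by rewrite mulr_gt0//= (lt_trans _ t2)// gtr_pMr.
have {}P2 := P2 _ tmu.
have st0 : 0 < Num.sqrt t by rewrite sqrtr_gt0.
(* [u_reflection] is used at the reflection of [p + t nu1], whose dilation is [q + t mu nu2]. *)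
have : u (p + t *: nu1) <= u (q + (t * mu) *: nu2).
  rewrite nuE -shift -{1}(reflK c e1 (p + t *: nu1)); apply: u_reflection => //.
    by rewrite mu0 ltW.
  by rewrite dot_refl//; have := P3 t; rewrite t0 t3 => /(_ isT) h; lra.
move: P1 P2; rewrite (u_bd _ bp) (u_bd _ bq) !subr0 (sqrtrM mu (ltW t0)).
set U1 := u _; set U2 := u _.
rewrite !ltr_norml => /andP[_ a1] /andP[a2 _] UU.
have b1 : lambda - eps < U1 / Num.sqrt t by lra.
have b2 : U2 / (Num.sqrt t * Num.sqrt mu) < lambda + eps by lra.
move: b1 b2; rewrite ltr_pdivlMr// ltr_pdivrMr ?mulr_gt0// => b1 b2.
have : (lambda - eps) * Num.sqrt t < (lambda + eps) * Num.sqrt mu * Num.sqrt t.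
  by rewrite -[ltRHS]mulrA [_ * Num.sqrt t in ltRHS]mulrC; lra.
rewrite ltr_pM2r// /eps => b3.
have : 0 < lambda * (1 - Num.sqrt mu) by rewrite mulr_gt0// subr_gt0.
have : lambda * (1 - Num.sqrt mu) * Num.sqrt mu <= lambda * (1 - Num.sqrt mu).
  by rewrite ger_pMr ?mulr_gt0 ?subr_gt0// ltW.
by lra.
Qed.

(** The admissible ratios [S] form an interval containing its supremum [m]; [m < 1] would produce a
    contact excluded by [no_touching_point]. *)
Lemma refl_sub e c lambda p : dot e e = 1 -> (forall y, closure K y -> dot y e <= c) ->
  0 < lambda -> (forall x, boundary Omega x -> half_normal_derivative Omega u x lambda) ->
  Omega p -> c < dot p e -> Omega (refl e c p).
Proof.
move=> e1 Kc lam0 Du.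
pose S mu := 0 < mu <= 1 /\ forall q, Omega q -> c < dot q e -> Omega (dil mu (refl e c q)).
suff [_ S1] : S 1 by move=> Op pc; rewrite -(dilation1 x0 (refl e c p)); exact: S1.
have crefl := @refl_continuous R d e c.
have S_down mu nu : S nu -> 0 < mu <= nu -> S mu.
  move=> [/andP[nu0 nu1] H] /andP[mu0 munu]; split; first by rewrite mu0 (le_trans munu).
  move=> q Oq qc; have -> : dil mu (refl e c q) = dil (mu / nu) (dil nu (refl e c q)).
    by rewrite dilationM divfK// gt_eqF.
  apply: (starshaped_dilation r_gt0 Omega_star); last exact: H.
  by rewrite divr_ge0 ?(ltW mu0) ?(ltW nu0)//= ler_pdivrMr// mul1r.
(* A small ratio shrinks the bounded reflected cap into a ball around [x0] inside [Omega]. *)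
have [mu1 Smu1] : exists mu, S mu.
  have Ox0 : Omega x0 by have [] := Omega_star x0_r.
  have /nbhs_ballP[del /= del0 ball_Omega] := open_nbhs_nbhs (conj Omega_open Ox0).
  have [M0 OmegaM] := bounded_setP Omega_bounded.
  have [M far] := continuous_far M0 crefl (reflK c e1).
  pose B := `|M| + `|x0| + 1.
  have B0 : 0 < B by rewrite ltr_wpDl// addr_ge0.
  exists (Num.min 1 (del / 2 / B)); split.
    by rewrite lt_min ltr01 ge_min lexx /= !divr_gt0.
  move=> q Oq qc; apply: ball_Omega; rewrite -ball_normE /= /dilation opprD addrCA subrr addr0 normrN.
  set mu := Num.min _ _; have mu0 : 0 < mu by rewrite lt_min ltr01 !divr_gt0.
  have : mu * B <= del / 2 by rewrite -ler_pdivlMr// ge_min lexx orbT.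
  have qB : `|refl e c q - x0| <= B.
    rewrite (le_trans (ler_normB _ _))// /B.
    have : `|refl e c q| <= M.
      by rewrite leNgt; apply/negP => /far; rewrite (reflK c e1) ltNge OmegaM.
    by have := ler_norm M; lra.
  by rewrite normrZ gtr0_norm// => H; have := ler_wpM2l (ltW mu0) qB; lra.
have supS : has_sup S by split; [exists mu1|exists 1 => mu [/andP[]]].
pose m := sup S.
have m1 : m <= 1 by apply: ge_sup; [exists mu1|move=> mu [/andP[]]].
have m0 : 0 < m.
  by case: (Smu1) => /andP[h _] _; apply: lt_le_trans h _; exact: sup_upper_bound.
have S_lt mu : 0 < mu < m -> S mu.
  move=> /andP[mu0 mum]; have eps : 0 < m - mu by rewrite subr_gt0.
  have [nu Snu] := sup_adherent eps supS; rewrite -/m subKr => munu.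
  by apply: S_down Snu _; rewrite mu0 ltW.
have Sm : S m.
  split; first by rewrite m0.
  (* The cap is open, so [q] may be replaced by a nearby [phi (1 + del / 2)], from whose reflection
     the same image is reached with a ratio below [m]. *)
  move=> q Oq qc; pose phi t := refl e c (dil t (refl e c q)).
  have phi1 : phi 1 = q by rewrite /phi dilation1 reflK.
  have cphi : {for 1, continuous phi}.
    have cd : {for 1, continuous (fun t => dil t (refl e c q))}.
      exact: (cvgD (cvgZ cvg_id (cvg_cst (refl e c q - x0))) (cvg_cst x0)).
    exact: (continuous_comp cd (crefl _)).
  have opn : open [set y : Rd | c < dot y e].
    rewrite (_ : mkset _ = (fun y : Rd => dot y e) @^-1` [set t | c < t])//.
    by apply: open_comp; [move=> y _; exact: dot_continuous|exact: open_gt].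
  have : nbhs (phi 1) (Omega `&` [set y : Rd | c < dot y e]).
    by rewrite phi1; apply: open_nbhs_nbhs; split; [exact: openI|split].
  move=> /cphi/nbhs_ballP[del /= del0 H].
  have t0 : 0 < 1 + del / 2 by rewrite addr_gt0// divr_gt0.
  have [|Ot ct] := H (1 + del / 2).
    by rewrite /ball /= opprD addrA subrr sub0r normrN gtr0_norm ?divr_gt0//; lra.
  have -> : dil m (refl e c q) = dil (m / (1 + del / 2)) (refl e c (phi (1 + del / 2))).
    by rewrite /phi reflK// dilationM divfK// gt_eqF.
  apply: (S_lt _ _).2 Ot ct; rewrite divr_gt0//= ltr_pdivrMr// ltr_pMr// ltrDl divr_gt0//.
have [<-//|m_neq1] := eqVneq m 1; exfalso.
have {m_neq1}m_lt1 : m < 1 by rewrite lt_neqAle m_neq1.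
pose A := closure Omega `&` [set q : Rd | c <= dot q e].
have cA : compact A.
  apply: bounded_closed_compact; last first.
    apply: closedI; first exact: closed_closure.
    rewrite (_ : mkset _ = (fun q : Rd => dot q e) @^-1` [set t | c <= t])//.
    apply: closed_comp; last exact: closed_ge.
    by move=> q _; exact: dot_continuous.
  by apply: bounded_setS (bounded_closure Omega_bounded) => q [].
(* If even the closed cap is sent into [Omega], compactness keeps this true for ratios slightly
   above [m]. *)
have [allA|] := pselect (forall q, A q -> Omega (dil m (refl e c q))).
  have : \forall mu \near m, A `<=` (fun q => Omega (dil mu (refl e c q))).
    have /compact_near_coveringP/(_ _ (nbhs m) (fun mu q => Omega (dil mu (refl e c q)))) := cA.
    apply => q Aq.
    have cf : {for (q, m), continuous (fun z : Rd * R => dil z.2 (refl e c z.1))}.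
      have c1 : {for (q, m), continuous (fun z : Rd * R => refl e c z.1)}.
        exact: (@continuous_comp _ _ _ fst (refl e c) (q, m) cvg_fst (crefl q)).
      exact: (cvgD (cvgZ cvg_snd (cvgB c1 (cvg_cst x0))) (cvg_cst x0)).
    by have := cf _ (open_nbhs_nbhs (conj Omega_open (allA _ Aq))).
  move=> /nbhs_ballP[del /= del0 H].
  pose mu := Num.min 1 (m + del / 2).
  have mum : m < mu by rewrite lt_min m_lt1 ltrDl divr_gt0.
  have Smu : S mu.
    split; first by rewrite (lt_trans m0 mum) ge_min lexx.
    move=> q Oq qc; apply: (H mu); last by split; [exact: subset_closure|exact: ltW].
    have : mu <= m + del / 2 by rewrite ge_min lexx orbT.
    by rewrite /ball /= ltr0_norm ?subr_lt0// => h; lra.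
  by have := sup_upper_bound supS Smu; rewrite leNgt mum.
move=> /existsNP[p0 /not_implyP[[clp0 /= p0c] nOp0]].
(* A point of the hyperplane is its own reflection, and the ratio [m < 1] sends the closure of
   [Omega] into [Omega]. *)
have {}p0c : c < dot p0 e.
  rewrite lt_neqAle p0c andbT; apply/eqP => cE; apply: nOp0.
  have -> : refl e c p0 = p0 by rewrite /refl -cE subrr mulr0 scale0r subr0.
  by apply: (starshaped_closure_dilation r_gt0 Omega_star _ clp0); rewrite ltW.
have notO : ~ Omega p0 by move=> O0; apply: nOp0; exact: Sm.2.
have bd q : closure Omega q -> ~ Omega q -> boundary Omega q.
  by move=> clq nOq; split => //; move: Omega_open => /interior_id ->.
(* The image of [p0] is a limit of images of points of the cap; as it is not in [Omega], it is a
   boundary point. *)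
have clq0 : closure Omega (dil m (refl e c p0)).
  move=> B nB.
  have cg : {for p0, continuous (dil m \o refl e c)}.
    exact: (continuous_comp (crefl p0) (@dilation_continuous R d x0 m _)).
  have opn : open [set y : Rd | c < dot y e].
    rewrite (_ : mkset _ = (fun y : Rd => dot y e) @^-1` [set t | c < t])//.
    by apply: open_comp; [move=> y _; exact: dot_continuous|exact: open_gt].
  have nB' : nbhs p0 ((dil m \o refl e c) @^-1` B) := cg _ nB.
  have [a [Oa [Ba ac]]] := clp0 _ (filterI nB' (open_nbhs_nbhs (conj opn p0c))).
  by exists (dil m (refl e c a)); split => //; exact: Sm.2.
apply: (@no_touching_point e c m lambda p0) => //; rewrite ?m0//.
- exact: Sm.2.
- exact: bd.
- exact: bd.
- by apply: Du; exact: bd.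
- by apply: Du; exact: bd.
Qed.

End bernoulli.

(** * Normal rays meet the hull, by reflection in a hyperplane through the boundary point *)

Theorem theorem1p4 (R : realType) (d : nat) (d_ge1 : (1 <= d)%N)
    (K : set 'rV[R]_d) (x0 : 'rV[R]_d) (r lambda : R)
    (K_domain : domain K) (K_bounded : bounded_set K)
    (K_C2 : has_boundary_of_class (class_C 2) K)
    (r_gt0 : 0 < r) (K_x0 : K x0) (K_starshaped : starshaped_wrt K (eball x0 r))
    (lambda_gt0 : 0 < lambda)
    (u : 'rV[R]_d -> R) (Omega : set 'rV[R]_d)
    (* (u, Omega) is the unique solution; the problem is understood in the
       class of bounded Omega, without which (1, R^d) is always a solution *)
    (solution : exterior_bernoulli_solution K lambda u Omega)
    (Omega_bounded : bounded_set Omega)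
    (unique : forall (v : 'rV[R]_d -> R) (A : set 'rV[R]_d),
        exterior_bernoulli_solution K lambda v A -> bounded_set A ->
        v = u /\ A = Omega)
    (* known properties of the solution *)
    (Omega_starshaped : starshaped_wrt Omega (eball x0 r))
    (Omega_smooth : has_boundary_of_class class_Cinfty Omega)
    (u_H12 : in_H12 u) :
  forall x, boundary Omega x ->
  forall nu, inward_unit_normal Omega x nu ->
  exists2 t : R, 0 <= t & convex_hull (closure K) (x + t *: nu).
Proof.
move=> x bx nu nx; case: solution => [[u_cont u01] [[_ Omega_open _] _ K_Omega] u_harm [u_K u_Omega] Du].
have [nu1 Pin Pout] := inward_unit_normalP bx nx.
have K_compact : compact (closure K).
  by apply: bounded_closed_compact; [exact: bounded_setS K_Omega _|exact: closed_closure].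
have K_neq0 : closure K !=set0 by exists x0; exact: subset_closure.
apply: contrapT => no_t.
have [|e [e1 ne Ke]] := ray_separation (x := x) K_compact K_neq0 nu1.
  by move=> t t0 Ct; apply: no_t; exists t.
have u_meas : @rowmeas R d _ R u by case: u_H12.
have reflO := @refl_sub R d d_ge1 K Omega x0 r u r_gt0 K_starshaped Omega_starshaped Omega_open
  Omega_bounded u_cont u01 u_meas (fun y Hy => half_laplacian_eq0 d_ge1 (u_harm y Hy))
  u_K u_Omega e (dot x e) lambda _ e1 Ke lambda_gt0 Du.
have ne' : 0 < dot e nu by rewrite dotC.
have [d1 d10 P1] := Pin e ne'.
have [|d2 d20 P2] := Pout (- e); first by rewrite dotNl dotC oppr_lt0.
pose t := Num.min d1 d2 / 2.
have m0 : 0 < Num.min d1 d2 by rewrite lt_min d10.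
have t0 : 0 < t by rewrite divr_gt0.
have : t < Num.min d1 d2 by rewrite /t; lra.
rewrite lt_min => /andP[t1 t2].
apply: (P2 t); first by rewrite t0.
have -> : x + t *: - e = refl e (dot x e) (x + t *: e).
  rewrite /refl dotDl dotZl e1; apply/rowP => i; rewrite !mxE; ring.
apply: reflO; first by apply: P1; rewrite t0.
by rewrite dotDl dotZl e1 mulr1 ltrDl.
Qed.
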